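(* Let $k\ge2$ and let $P(\lambda)=\sum_{i=0}^{k}A_i\lambda^i$, $A_i\in\mathbb{C}^{n\times n}$, be a regular matrix polynomial of degree $k$ with $A_0\neq0$. Let $\delta$ be a simple, finite, nonzero eigenvalue of $P(\lambda)$. Let $C_1(\lambda)$ be the first Frobenius companion linearization of $P(\lambda)$. Let $$\rho':=\frac{\max_{i=0,\ldots,k}\{1,\|A_i\|_2^2\}}{\min\{\|A_k\|_2,\|A_0\|_2\}},\qquad \nu:=\frac{\min\left\{\max\{1,\|A_k\|_2\},\ \max_{i=0,\ldots,k-1}\{1,\|A_i\|_2\}\right\}}{\max_{i=0,\ldots,k}\{\|A_i\|_2\}}.$$ Then $$\frac{\nu}{k+1}\le\frac{\kappa_{C_1}(\delta)}{\kappa_P(\delta)}\le2\sqrt2\,k^3\rho'.$$ Moreover, if $|\delta|\ge\sqrt{(k-1)^3}$ or $|\delta|\le\frac12$, then $$\frac{\kappa_{C_1}(\delta)}{\kappa_P(\delta)}\le\frac43\,k(1+k)\rho'.$$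
   Context: $\|\cdot\|_2$ is the Euclidean norm of vectors and the spectral norm of matrices. $P$ has degree $k$ if $A_k\neq0$, and is regular if $\det P(\lambda)$ is not identically zero. Condition number. For a regular matrix polynomial $Q(\lambda)=\sum_{i=0}^{d}B_i\lambda^i$ of degree $d$ (in particular for a pencil $Q(\lambda)=\lambda L_1-L_0$) and a simple, finite, nonzero eigenvalue $\delta$ with right eigenvector $x$, the relative normwise condition number with natural weights is $$\kappa_Q(\delta)=\lim_{\epsilon\to0}\sup\Big\{\tfrac{|\Delta\delta|}{\epsilon|\delta|}:[Q(\delta+\Delta\delta)+\Delta Q(\delta+\Delta\delta)](x+\Delta x)=0,\ \|\Delta B_i\|_2\le\epsilon\|B_i\|_2,\ i=0,\ldots,d\Big\},$$ where $\Delta Q(\lambda)=\sum_i\lambda^i\Delta B_i$. It is known that, for any right and left eigenvectors $x,y$ associated with $\delta$ (i.e. nonzero vectors with $Q(\delta)x=0$, $y^*Q(\delta)=0$), $$\kappa_Q(\delta)=\frac{\left(\sum_{i=0}^{d}|\delta|^i\|B_i\|_2\right)\|y\|_2\|x\|_2}{|\delta|\,|y^*Q'(\delta)x|}.$$ First Frobenius companion linearization: $$C_1(\lambda)=\lambda\begin{bmatrix} A_k & & & \\ & I_n & & \\ & & \ddots & \\ & & & I_n \end{bmatrix}-\begin{bmatrix} -A_{k-1} & -A_{k-2} & \cdots & -A_0 \\ I_n & 0 & \cdots & 0 \\ \vdots & \ddots & \ddots & \vdots \\ 0 & \cdots & I_n & 0 \end{bmatrix}$$ (an $nk\times nk$ pencil).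 *)

(* Defs.v *)
From HB Require Import structures.
From mathcomp Require Import all_boot all_order all_algebra complex.
From mathcomp Require Import all_classical all_reals all_analysis.
Import Order.TTheory GRing.Theory Num.Theory ComplexField.Normc.
Import numFieldNormedType.Exports.

Set Implicit Arguments.
Unset Strict Implicit.
Unset Printing Implicit Defensive.

Local Open Scope classical_set_scope.
Local Open Scope ring_scope.
Local Open Scope complex_scope.

Section MatrixPolynomials.
Variable R : realType.
Local Notation C := R[i].

Definition vnorm2 n (x : 'cV[C]_n) : R :=
  Num.sqrt (\sum_(i < n) normc (x i 0) ^+ 2).

(* The unit ball, rather than the unit sphere, keeps the set nonempty when
   n = 0. *)
Definition specnorm m n (M : 'M[C]_(m, n)) : R :=
  sup [set vnorm2 (M *m x) | x in [set x : 'cV[C]_n | vnorm2 x <= 1]].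

Definition matpoly d n := 'I_d.+1 -> 'M[C]_n.

Definition mpeval d n (Q : matpoly d n) (z : C) : 'M[C]_n :=
  \sum_(i < d.+1) z ^+ i *: Q i.

Definition mpdet d n (Q : matpoly d n) : {poly C} :=
  \det (\sum_(i < d.+1) 'X^i *: map_mx polyC (Q i)).

Definition regular d n (Q : matpoly d n) : Prop := mpdet Q != 0.

Definition simple_eigenvalue d n (Q : matpoly d n) (delta : C) : Prop :=
  mup delta (mpdet Q) = 1%N.

Definition right_eigvec d n (Q : matpoly d n) (delta : C) (x : 'cV[C]_n) :=
  x != 0 /\ mpeval Q delta *m x = 0.

Definition rel_changes d n (Q : matpoly d n) (delta : C) (x : 'cV[C]_n)
    (r eps : R) : set R :=
  [set t | exists (ddelta : C) (dx : 'cV[C]_n) (dQ : matpoly d n),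
    [/\ normc ddelta <= r /\ vnorm2 dx <= r,
        x + dx != 0,
        (mpeval Q (delta + ddelta) + mpeval dQ (delta + ddelta))
          *m (x + dx) = 0,
        forall i, specnorm (dQ i) <= eps * specnorm (Q i) &
        t = normc ddelta / (eps * normc delta)]].

(* The supremum is over perturbed eigenpairs near (delta, x), i.e. within a
   radius r that is sent to 0 after eps: otherwise x + dx = 0, or a perturbed
   eigenvalue close to another eigenvalue of Q, would make it infinite. *)
Definition condnum d n (Q : matpoly d n) (delta : C) (x : 'cV[C]_n) : R :=
  lim (lim (sup (rel_changes Q delta x r eps) @[eps --> 0^'+]) @[r --> 0^'+]).

Definition pencil n (L1 L0 : 'M[C]_n) : matpoly 1 n :=
  fun i => if i == ord0 then - L0 else L1.

(* In the first block row of the second matrix, the block in column j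
   (from 0) is - A_(k-1-j), and [rev_ord j] is k-1-j. *)
Definition frobenius1 k n (A : matpoly k n) : matpoly 1 (\sum_(i < k) n) :=
  pencil
    (\mxdiag_(i < k) (if i == 0%N :> nat then A ord_max else 1%:M : 'M[C]_n))
    (\mxblock_(i < k, j < k)
       (if i == 0%N :> nat then - A (widen_ord (leqnSn k) (rev_ord j))
        else if i == j.+1 :> nat then 1%:M else 0 : 'M[C]_n)).

Definition rho' k n (A : matpoly k n) : R :=
  (\big[Num.max/1]_(i < k.+1) (specnorm (A i) ^+ 2))
    / Num.min (specnorm (A ord_max)) (specnorm (A ord0)).

Definition nu k n (A : matpoly k n) : R :=
  Num.min (Num.max 1 (specnorm (A ord_max)))
          (\big[Num.max/1]_(i < k) specnorm (A (widen_ord (leqnSn k) i)))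
    / (\big[Num.max/0]_(i < k.+1) specnorm (A i)).

End MatrixPolynomials.

(* Main.v *)
Require Import Defs.
From HB Require Import structures.
From mathcomp Require Import all_boot all_order all_algebra complex.
From mathcomp Require Import all_classical all_reals all_analysis.
From mathcomp Require Import ring lra.
Import Order.TTheory GRing.Theory Num.Theory ComplexField.Normc.
Import numFieldNormedType.Exports.

(** For a row [w] and a column [x] spanning the left and right kernels of
    [Q(delta)], with [w Q'(delta) x <> 0], the supremum defining the condition
    number is squeezed, for every small fixed radius [r], between two explicit
    functions of [eps] with the common limit
    [(sum_i |delta|^i |Q_i|) |w| |x| / (|delta| |w Q'(delta) x|)].
    For [C_1] the kernels are spanned by the column of the [delta^(k-1-j) x] and
    the row [(w, w H_1, ..., w H_(k-1))] of Horner shifts of [P], and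
    [w P'(delta) x] is the same number for [P] and for [C_1].  The ratio is thus
    a product of norms, which is estimated with the Horner recursion run forward
    when [|delta| <= 1] and backward, from [w P(delta) = 0], when
    [|delta| >= 1]. *)

Set Implicit Arguments.
Unset Strict Implicit.
Unset Printing Implicit Defensive.

Local Open Scope classical_set_scope.
Local Open Scope ring_scope.
Local Open Scope complex_scope.

(** The inner limit in [eps] is taken at a fixed radius [r], where an error of order [r] does not
    vanish. So the perturbed eigenvector has to be compared with a multiple of [x] up to order
    [eps], which takes a partial inverse of [Q(delta)] off the line of [x]. That the kernel is this
    line, and that [w Q'(delta) x] is nonzero, is read off the adjugate of [Q].

    In the ratio the powers of [T = max(1, |delta|)] cancel. Let [P] have degree [k], let [m] be the
    minimum in [rho'], [M^2] its numerator, [N] the numerator of [nu] and [a] its denominator. The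
    weight of [P] lies between [m T^k] and [(k+1) a T^k], that of [C_1] between [N T] and
    [(k+1) M T], and the right vector between [T^(k-1) |x|] and [sqrt k T^(k-1) |x|]. One factor [M]
    of [rho'] comes from the weight of [C_1], the other from the left vector. The bound on the left
    vector separates the cases: [k^(3/2) M |w|] in general, [sqrt 2 M |w|] once
    [|delta|^2 >= (k-1)^3], and [sqrt(4k-3) M |w|] when [|delta| <= 1/2]. *)

(** Lagrange's identity: the double sum of the squares of [a i * b j - a j * b i] is twice the
    difference of the two sides. *)
Lemma sum_mul_sqr_le (R : realType) (I : finType) (a b : I -> R) :
  (\sum_i a i * b i) ^+ 2 <= (\sum_i a i ^+ 2) * (\sum_i b i ^+ 2).
Proof.
rewrite -subr_ge0.
have H : 0 <= \sum_i \sum_j (a i * b j - a j * b i) ^+ 2.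
  by apply: sumr_ge0 => i _; apply: sumr_ge0 => j _; exact: sqr_ge0.
suff E : \sum_i \sum_j (a i * b j - a j * b i) ^+ 2 =
  2 * ((\sum_i a i ^+ 2) * (\sum_i b i ^+ 2) - (\sum_i a i * b i) ^+ 2).
  by rewrite E pmulr_rge0 in H.
have E1 i j : (a i * b j - a j * b i) ^+ 2 =
  a i ^+ 2 * b j ^+ 2 + b i ^+ 2 * a j ^+ 2 - 2 * ((a i * b i) * (a j * b j)) by ring.
under eq_bigr => i _.
  under eq_bigr => j _ do rewrite E1.
  rewrite big_split /= sumrN big_split /= -!mulr_sumr.
  over.
rewrite big_split /= sumrN big_split /= -mulr_sumr -!mulr_suml.
by ring.
Qed.

(** * Euclidean and spectral norms *)

Section Norms.
Context {R : realType}.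
Local Notation C := R[i].

Lemma normc_ge0 (z : C) : 0 <= normc z.
Proof. by case: z => a b; exact: sqrtr_ge0. Qed.

Lemma normcX (z : C) i : normc (z ^+ i) = normc z ^+ i.
Proof. by elim: i => [|i IH]; rewrite ?expr0 ?normc1 // !exprS normcM IH. Qed.

Lemma normc_eq0 (z : C) : (normc z == 0) = (z == 0).
Proof. by apply/eqP/eqP => [/eq0_normc //|->]; exact: normc0. Qed.

Lemma normc_gt0 (z : C) : (0 < normc z) = (z != 0).
Proof. by rewrite lt_neqAle normc_ge0 andbT eq_sym normc_eq0. Qed.

Lemma normc_conj (z : C) : normc (conjc z) = normc z.
Proof. by case: z => a b; rewrite /normc /= sqrrN. Qed.

Lemma normc_real (a : R) : 0 <= a -> normc (a%:C) = a.
Proof. by move=> a0; rewrite /normc /= expr0n addr0 sqrtr_sqr ger0_norm. Qed.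

Lemma conjcM_normc (z : C) : conjc z * z = (normc z ^+ 2)%:C.
Proof.
case: z => a b; rewrite /normc sqr_sqrtr ?addr_ge0 ?sqr_ge0 //.
by apply/eqP; rewrite eq_complex /=; apply/andP; split; apply/eqP; ring.
Qed.

Lemma normcB (z w : C) : normc (z - w) = normc (w - z).
Proof. by rewrite -normcN opprB. Qed.

Lemma normc_sub_le (z w : C) : normc z - normc w <= normc (z - w).
Proof. by rewrite lerBlDr -{1}(subrK w z) le_normcD. Qed.

Lemma normc_natr j : normc (j%:R : C) = j%:R.
Proof. by rewrite normcMn normc1. Qed.

Lemma normc_sum (I : finType) (F : I -> C) :
  normc (\sum_i F i) <= \sum_i normc (F i).
Proof.
apply: (big_ind2 (fun u v => normc u <= v)) => // [|u1 v1 u2 v2 h1 h2].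
  by rewrite normc0.
by apply: (le_trans (le_normcD _ _)); rewrite lerD.
Qed.

Lemma vnorm2_ge0 n (x : 'cV[C]_n) : 0 <= vnorm2 x.
Proof. exact: sqrtr_ge0. Qed.

Lemma vnorm2_sqr n (x : 'cV[C]_n) : vnorm2 x ^+ 2 = \sum_i normc (x i 0) ^+ 2.
Proof. by rewrite sqr_sqrtr // sumr_ge0 // => i _; rewrite sqr_ge0. Qed.

Lemma vnorm2_sqr_mul n (x : 'cV[C]_n) :
  (map_mx (@conjc R) x^T *m x) 0 0 = (vnorm2 x ^+ 2)%:C.
Proof.
rewrite vnorm2_sqr mxE rmorph_sum /=; apply: eq_bigr => i _.
by rewrite !mxE conjcM_normc.
Qed.

Lemma vnorm2_le_sqr n m (x : 'cV[C]_n) (y : 'cV[C]_m) c : 0 <= c ->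
  vnorm2 x ^+ 2 <= c ^+ 2 * vnorm2 y ^+ 2 -> vnorm2 x <= c * vnorm2 y.
Proof.
by move=> c0; rewrite -exprMn ler_pXn2r ?nnegrE ?mulr_ge0 ?vnorm2_ge0.
Qed.

Lemma vnorm20 n : vnorm2 (0 : 'cV[C]_n) = 0.
Proof.
by rewrite /vnorm2 big1 ?sqrtr0 // => i _; rewrite mxE normc0 expr0n.
Qed.

Lemma vnorm2_eq0 n (x : 'cV[C]_n) : (vnorm2 x == 0) = (x == 0).
Proof.
apply/eqP/eqP => [H|->]; last exact: vnorm20.
have : \sum_i normc (x i 0) ^+ 2 = 0 by rewrite -vnorm2_sqr H expr0n.
move/psumr_eq0P => K; apply/colP => i; rewrite mxE.
have /eqP := K (fun i _ => sqr_ge0 _) i isT.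
by rewrite sqrf_eq0 normc_eq0 => /eqP.
Qed.

Lemma vnorm2_gt0 n (x : 'cV[C]_n) : (0 < vnorm2 x) = (x != 0).
Proof. by rewrite lt_neqAle vnorm2_ge0 andbT eq_sym vnorm2_eq0. Qed.

Lemma vnorm2Z n c (x : 'cV[C]_n) : vnorm2 (c *: x) = normc c * vnorm2 x.
Proof.
apply: (@pexpIrn _ 2) => //; rewrite ?nnegrE ?mulr_ge0 ?vnorm2_ge0 ?normc_ge0 //.
rewrite exprMn !vnorm2_sqr mulr_sumr; apply: eq_bigr => i _.
by rewrite mxE normcM exprMn.
Qed.

Lemma vnorm2N n (x : 'cV[C]_n) : vnorm2 (- x) = vnorm2 x.
Proof.
by rewrite /vnorm2; congr Num.sqrt; apply: eq_bigr => i _; rewrite mxE normcN.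
Qed.

Lemma sum_normc_mul_le n (x y : 'cV[C]_n) :
  \sum_i normc (x i 0) * normc (y i 0) <= vnorm2 x * vnorm2 y.
Proof.
have P0 : 0 <= \sum_i normc (x i 0) * normc (y i 0).
  by apply: sumr_ge0 => i _; rewrite mulr_ge0 ?normc_ge0.
rewrite -(@ler_pXn2r _ 2) ?nnegrE ?mulr_ge0 ?vnorm2_ge0 //.
by rewrite exprMn !vnorm2_sqr sum_mul_sqr_le.
Qed.

Lemma vnorm2D n (x y : 'cV[C]_n) : vnorm2 (x + y) <= vnorm2 x + vnorm2 y.
Proof.
rewrite -(@ler_pXn2r _ 2) ?nnegrE ?addr_ge0 ?vnorm2_ge0 //.
rewrite sqrrD {1}vnorm2_sqr.
apply: (@le_trans _ _ (\sum_i (normc (x i 0) ^+ 2 +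
   normc (x i 0) * normc (y i 0) *+ 2 + normc (y i 0) ^+ 2))).
  apply: ler_sum => i _; rewrite -sqrrD ler_pXn2r ?nnegrE ?addr_ge0 ?normc_ge0 //.
  by rewrite mxE le_normcD.
rewrite big_split /= big_split /= -!vnorm2_sqr lerD2r lerD2l sumrMnl.
by rewrite lerMn2r sum_normc_mul_le orbT.
Qed.

Lemma vnorm2_sub_le n (x y : 'cV[C]_n) : vnorm2 x - vnorm2 y <= vnorm2 (x - y).
Proof. by rewrite lerBlDr -{1}(subrK y x) vnorm2D. Qed.

Lemma vnorm2_sum n (I : finType) (F : I -> 'cV[C]_n) :
  vnorm2 (\sum_i F i) <= \sum_i vnorm2 (F i).
Proof.
apply: (big_ind2 (fun u v => vnorm2 u <= v)) => // [|u1 v1 u2 v2 h1 h2].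
  by rewrite vnorm20.
by apply: (@le_trans _ _ (vnorm2 u1 + vnorm2 u2)); [exact: vnorm2D|rewrite lerD].
Qed.

Lemma normc_mul_le n (u : 'rV[C]_n) (v : 'cV[C]_n) :
  normc ((u *m v) 0 0) <= vnorm2 u^T * vnorm2 v.
Proof.
rewrite mxE; apply: (le_trans (normc_sum _)).
under eq_bigr => i _ do rewrite normcM.
apply: (le_trans _ (sum_normc_mul_le u^T v)).
by apply: ler_sum => i _; rewrite mxE.
Qed.

(** The Frobenius norm serves as [c], by Cauchy-Schwarz on each row. This bounds the set whose
    supremum is [specnorm], so that the supremum is not a default value. *)
Lemma vnorm2_mulmx_bound m n (M : 'M[C]_(m, n)) :
  exists2 c, 0 <= c & forall v, vnorm2 (M *m v) <= c * vnorm2 v.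
Proof.
have s0 : 0 <= \sum_i vnorm2 (row i M)^T ^+ 2.
  by apply: sumr_ge0 => i _; rewrite sqr_ge0.
exists (Num.sqrt (\sum_i vnorm2 (row i M)^T ^+ 2)); first exact: sqrtr_ge0.
move=> v; apply: vnorm2_le_sqr; first exact: sqrtr_ge0.
rewrite (sqr_sqrtr s0) vnorm2_sqr mulr_suml; apply: ler_sum => i _.
rewrite -exprMn ler_pXn2r ?nnegrE ?mulr_ge0 ?vnorm2_ge0 ?normc_ge0 //.
by have := normc_mul_le (row i M) v; rewrite -row_mul mxE.
Qed.

Lemma specnorm_set_nonempty m n (M : 'M[C]_(m, n)) :
  [set vnorm2 (M *m x) | x in [set x : 'cV[C]_n | vnorm2 x <= 1]] 
    (vnorm2 (0 : 'cV[C]_m)).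
Proof. by exists 0; rewrite /= ?mulmx0 ?vnorm20 ?ler01. Qed.

Lemma vnorm2_mulmx m n (M : 'M[C]_(m, n)) v :
  vnorm2 (M *m v) <= specnorm M * vnorm2 v.
Proof.
have [v0|v0] := eqVneq v 0; first by rewrite v0 mulmx0 !vnorm20 mulr0.
have nv : 0 < vnorm2 v by rewrite vnorm2_gt0.
rewrite -ler_pdivrMr // /specnorm.
apply: ub_le_sup.
  have [c c0 Hc] := vnorm2_mulmx_bound M.
  exists c => _ [x /= x1 <-]; apply: (le_trans (Hc x)).
  by rewrite ler_piMr.
exists (((vnorm2 v)^-1)%:C *: v) => /=.
  by rewrite vnorm2Z normc_real ?invr_ge0 ?vnorm2_ge0 // mulVf // gt_eqF.
by rewrite -scalemxAr vnorm2Z normc_real ?invr_ge0 ?vnorm2_ge0 // mulrC.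
Qed.

Lemma specnorm_le m n (M : 'M[C]_(m, n)) c : 0 <= c ->
  (forall v, vnorm2 (M *m v) <= c * vnorm2 v) -> specnorm M <= c.
Proof.
move=> c0 H; apply: ge_sup; first by eexists; exact: specnorm_set_nonempty.
by move=> _ [x /= x1 <-]; apply: (le_trans (H x)); rewrite ler_piMr.
Qed.

Lemma specnorm_ge0 m n (M : 'M[C]_(m, n)) : 0 <= specnorm M.
Proof.
have [c c0 Hc] := vnorm2_mulmx_bound M.
rewrite -(vnorm20 m) /specnorm; apply: ub_le_sup.
  by exists c => _ [x /= x1 <-]; apply: (le_trans (Hc x)); rewrite ler_piMr.
exact: specnorm_set_nonempty.
Qed.

Lemma specnorm_gt0 m n (M : 'M[C]_(m, n)) : M != 0 -> 0 < specnorm M.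
Proof.
move=> M0; rewrite lt_neqAle specnorm_ge0 andbT; apply: contra M0 => /eqP s0.
apply/eqP/matrixP => i j; rewrite [RHS]mxE.
have /eqP : vnorm2 (M *m delta_mx j 0) = 0.
  apply/eqP; rewrite eq_le vnorm2_ge0 andbT.
  by apply: (le_trans (vnorm2_mulmx _ _)); rewrite -s0 mul0r.
rewrite vnorm2_eq0 -colE => /eqP/colP/(_ i).
by rewrite !mxE.
Qed.

(** A matrix and its adjoint have the same norm: for [u = w M] and [v] the conjugate transpose of
    [u], [|u|^2 = w (M v)] is at most [|w| |M| |u|], and one factor [|u|] cancels. *)
Lemma vnorm2_mulmxl m n (M : 'M[C]_(m, n)) (w : 'rV[C]_m) :
  vnorm2 (w *m M)^T <= specnorm M * vnorm2 w^T.
Proof.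
set u := w *m M; have [u0|u0] := eqVneq (vnorm2 u^T) 0.
  by rewrite u0 mulr_ge0 ?specnorm_ge0 ?vnorm2_ge0.
have up : 0 < vnorm2 u^T by rewrite lt_neqAle eq_sym u0 vnorm2_ge0.
rewrite -(ler_pM2r up) -expr2.
pose v := (map_mx (@conjc R) u)^T.
have nv : vnorm2 v = vnorm2 u^T.
  by rewrite /vnorm2; congr Num.sqrt; apply: eq_bigr => i _; rewrite !mxE normc_conj.
have -> : vnorm2 u^T ^+ 2 = normc ((w *m (M *m v)) 0 0).
  rewrite mulmxA -/u -[LHS](@normc_real) ?sqr_ge0 // -vnorm2_sqr_mul; congr normc.
  by rewrite !mxE; apply: eq_bigr => i _; rewrite !mxE mulrC.
apply: (le_trans (normc_mul_le _ _)).
rewrite mulrAC [leRHS]mulrC ler_wpM2l ?vnorm2_ge0 // -nv; exact: vnorm2_mulmx.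
Qed.

Lemma specnorm_rank1 m n (u : 'cV[C]_m) (v : 'cV[C]_n) :
  specnorm (u *m (map_mx (@conjc R) v^T)) <= vnorm2 u * vnorm2 v.
Proof.
apply: specnorm_le => [|x]; first by rewrite mulr_ge0 ?vnorm2_ge0.
set f := map_mx _ _; have nf : vnorm2 f^T = vnorm2 v.
  by rewrite /vnorm2; congr Num.sqrt; apply: eq_bigr => i _; rewrite !mxE normc_conj.
rewrite -mulmxA [f *m x]mx11_scalar mul_mx_scalar vnorm2Z mulrC -mulrA.
by rewrite ler_wpM2l ?vnorm2_ge0 // -nf normc_mul_le.
Qed.

End Norms.

(** * The condition number formula *)

Section Perturbation.
Context {R : realType}.
Local Notation C := R[i].

(** At [i = 0] the truncated exponent [i.-1] does no harm, since the coefficient [i%:R] is zero. *)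
Definition mpderiv d n (Q : matpoly R d n) (z : C) : 'M[C]_n :=
  \sum_(i < d.+1) (i%:R * z ^+ i.-1) *: Q i.

(** At [z = delta] this is the sum in the numerator of the closed formula. It bounds the norm of
    [Q(z)], and [eps] times it bounds the value at [z] of every perturbation admissible at level
    [eps]. *)
Definition mpweight d n (Q : matpoly R d n) (z : C) : R :=
  \sum_(i < d.+1) normc z ^+ i * specnorm (Q i).

(** Induction on [i]: the remainder for [i.+1] is [z + h] times the remainder for [i], plus
    [i z^(i-1) h^2]. The restriction on [h] keeps [|z + h|] below [|z| + 1]. *)
Lemma normc_expD_taylor (z : C) i :
  exists2 K, 0 <= K & forall h, normc h <= 1 ->
    normc ((z + h) ^+ i - z ^+ i - i%:R * z ^+ i.-1 * h) <= K * normc h ^+ 2.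
Proof.
elim: i => [|i [K K0 IH]].
  by exists 0 => // h _; rewrite !expr0 !mul0r subrr subr0 normc0.
exists ((normc z + 1) * K + i%:R * normc z ^+ i.-1) => [|h h1].
  rewrite addr_ge0 ?mulr_ge0 ?addr_ge0 ?normc_ge0 //.
  by rewrite exprn_ge0 ?normc_ge0.
set e := (z + h) ^+ i - z ^+ i - i%:R * z ^+ i.-1 * h.
have -> : (z + h) ^+ i.+1 - z ^+ i.+1 - i.+1%:R * z ^+ i.+1.-1 * h =
   (z + h) * e + i%:R * z ^+ i.-1 * h ^+ 2.
  rewrite /e /= -[i.+1%:R]natr1 !exprS.
  case: i {K0 IH e} => [|i] /=; first by rewrite !expr0; ring.
  by rewrite !exprS; ring.
rewrite (le_trans (le_normcD _ _)) // !normcM normc_natr !normcX [leRHS]mulrDl lerD //.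
rewrite -mulrA ler_pM ?normc_ge0 ?IH //.
by rewrite (le_trans (le_normcD _ _)) // lerD2l.
Qed.

Lemma normc_expD_lipschitz (z : C) i :
  exists2 K, 0 <= K & forall h, normc h <= 1 ->
    `|normc (z + h) ^+ i - normc z ^+ i| <= K * normc h.
Proof.
have [K K0 HK] := normc_expD_taylor z i.
exists (K + i%:R * normc z ^+ i.-1) => [|h h1].
  by rewrite addr_ge0 ?mulr_ge0 ?exprn_ge0 ?normc_ge0.
have H : normc ((z + h) ^+ i - z ^+ i) <= (K + i%:R * normc z ^+ i.-1) * normc h.
  rewrite -[X in normc X](subrK (i%:R * z ^+ i.-1 * h)).
  rewrite (le_trans (le_normcD _ _)) // mulrDl !normcM normc_natr !normcX lerD //.
  rewrite (le_trans (HK h h1)) // ler_wpM2l // expr2.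
  by rewrite ler_piMl ?normc_ge0.
rewrite -(normcX (z + h)) -(normcX z i) ler_norml; apply/andP; split.
  by rewrite lerNl opprB (le_trans (normc_sub_le _ _)) // normcB.
by rewrite (le_trans (normc_sub_le _ _)).
Qed.

Lemma mpweight_lipschitz d n (Q : matpoly R d n) z :
  exists2 K, 0 <= K & forall h, normc h <= 1 ->
    `|mpweight Q (z + h) - mpweight Q z| <= K * normc h.
Proof.
have [K HK] := choice (fun i : 'I_d.+1 =>
  let: ex_intro2 K K0 H := normc_expD_lipschitz z i in ex_intro _ K (conj K0 H)).
exists (\sum_i K i * specnorm (Q i)) => [|h h1].
  by apply: sumr_ge0 => i _; rewrite mulr_ge0 ?specnorm_ge0 ?(HK i).1.
rewrite /mpweight -sumrB mulr_suml (le_trans (ler_norm_sum _ _ _)) //.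
apply: ler_sum => i _.
rewrite -mulrBl normrM (ger0_norm (specnorm_ge0 _)) mulrAC.
by rewrite ler_wpM2r ?specnorm_ge0 ?(HK i).2.
Qed.

Lemma mpeval_taylor d n (Q : matpoly R d n) z :
  exists2 K, 0 <= K & forall h, normc h <= 1 ->
    exists2 E, mpeval Q (z + h) = mpeval Q z + h *: mpderiv Q z + E &
      forall v, vnorm2 (E *m v) <= K * normc h ^+ 2 * vnorm2 v.
Proof.
have [K HK] := choice (fun i : 'I_d.+1 =>
  let: ex_intro2 K K0 H := normc_expD_taylor z i in ex_intro _ K (conj K0 H)).
exists (\sum_i K i * specnorm (Q i)) => [|h h1].
  by apply: sumr_ge0 => i _; rewrite mulr_ge0 ?specnorm_ge0 ?(HK i).1.
exists (\sum_(i < d.+1)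
   ((z + h) ^+ i - z ^+ i - i%:R * z ^+ i.-1 * h) *: Q i) => [|v].
  rewrite /mpeval /mpderiv scaler_sumr -!big_split /=.
  apply: eq_bigr => i _; rewrite scalerA -!scalerDl; congr (_ *: _); ring.
rewrite mulmx_suml (le_trans (vnorm2_sum _)) // !mulr_suml; apply: ler_sum => i _.
rewrite -scalemxAl vnorm2Z (mulrAC (K i)) -[leRHS]mulrA.
rewrite ler_pM ?normc_ge0 ?vnorm2_ge0 //.
  exact: (HK i).2.
exact: vnorm2_mulmx.
Qed.

Lemma vnorm2_mpeval d n (Q : matpoly R d n) z v :
  vnorm2 (mpeval Q z *m v) <= mpweight Q z * vnorm2 v.
Proof.
rewrite mulmx_suml (le_trans (vnorm2_sum _)) // mulr_suml; apply: ler_sum => i _.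
rewrite -scalemxAl vnorm2Z normcX -mulrA ler_wpM2l ?exprn_ge0 ?normc_ge0 //.
exact: vnorm2_mulmx.
Qed.

(** A small residual [u = Q(z) v] is an exact backward error. Every [dQ i] is a multiple of the
    rank-one matrix [u v^*], scaled so that the term of index [i] cancels the share
    [|z|^i |Q_i| / mpweight Q z] of [u]; the shares add up to 1. *)
Lemma backward_perturbation d n (Q : matpoly R d n) z v eps :
  v != 0 -> 0 < mpweight Q z ->
  vnorm2 (mpeval Q z *m v) <= eps * (mpweight Q z * vnorm2 v) ->
  exists2 dQ : matpoly R d n, (mpeval Q z + mpeval dQ z) *m v = 0 &
    forall i, specnorm (dQ i) <= eps * specnorm (Q i).
Proof.
move=> v0 S0 H; set S := mpweight Q z in S0 H *; set u := mpeval Q z *m v.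
have nv : 0 < vnorm2 v by rewrite vnorm2_gt0.
(* The conjugate phase of [a]. Since division by zero gives [ph 0 = 0], the identity
   [a * ph a = |a|] holds for every [a]. *)
pose ph (a : C) : C := (normc a)%:C / a.
have phE a : a * ph a = (normc a)%:C.
  have [->|a0] := eqVneq a 0; first by rewrite normc0 mul0r.
  by rewrite /ph mulrC divfK.
have ph1 a : normc (ph a) <= 1.
  have [->|a0] := eqVneq a 0; first by rewrite /ph invr0 mulr0 normc0.
  by rewrite normcM normcV normc_real ?normc_ge0 // divff // normc_eq0.
pose c i : R := specnorm (Q i) / (S * vnorm2 v ^+ 2).
have c0 i : 0 <= c i by rewrite divr_ge0 ?specnorm_ge0 ?mulr_ge0 ?sqr_ge0 ?ltW.
exists (fun i => - ((c i)%:C * ph (z ^+ i)) *: (u *m map_mx (@conjc R) v^T)).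
  rewrite mulmxDl -/u mulmx_suml.
  under eq_bigr => i _.
    rewrite -!scalemxAl -mulmxA [_ v^T *m v]mx11_scalar vnorm2_sqr_mul.
    rewrite mul_mx_scalar !scalerA mulrN mulrCA phE normcX -rmorphM mulNr -rmorphM.
    over.
  rewrite -scaler_suml -[X in X + _]scale1r -scalerDl.
  suff -> : \sum_(i < d.+1) - ((c i * normc z ^+ i * vnorm2 v ^+ 2)%:C) = -1 :> C.
    by rewrite subrr scale0r.
  rewrite sumrN -rmorph_sum /=; congr (- _).
  rewrite (_ : \sum_(i < d.+1) _ = 1) //.
  transitivity (S / S); last by rewrite divff // gt_eqF.
  rewrite {1}/S /mpweight mulr_suml; apply: eq_bigr => i _.
  by rewrite /c; field; rewrite !gt_eqF.
move=> i; apply: specnorm_le => [|x].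
  have : 0 <= eps.
    have := le_trans (vnorm2_ge0 _) H.
    by rewrite pmulr_lge0 // mulr_gt0.
  by move=> e0; rewrite mulr_ge0 ?specnorm_ge0.
rewrite -scalemxAl vnorm2Z normcN normcM normc_real //.
apply: (@le_trans _ _ (c i * (vnorm2 u * vnorm2 v * vnorm2 x))).
  apply: ler_pM; rewrite ?vnorm2_ge0 //.
    exact: mulr_ge0 (c0 i) (normc_ge0 _).
    exact: ler_piMr (c0 i) (ph1 _).
  apply: (le_trans (vnorm2_mulmx _ _)).
  by rewrite ler_wpM2r ?vnorm2_ge0 ?specnorm_rank1.
rewrite mulrA ler_wpM2r ?vnorm2_ge0 //.
apply: (@le_trans _ _ (c i * (eps * (S * vnorm2 v) * vnorm2 v))).
  by rewrite ler_wpM2l // ler_wpM2r // ltW.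
by rewrite /c le_eqVlt; apply/orP; left; apply/eqP; field; rewrite !gt_eqF.
Qed.

End Perturbation.

Ltac nonneg := repeat first
  [ assumption | exact: ler0n | exact: ler01 | exact: normc_ge0
  | exact: vnorm2_ge0 | exact: specnorm_ge0 | exact: sqr_ge0
  | (apply: ltW; assumption) | apply: mulr_ge0 | apply: addr_ge0
  | apply: exprn_ge0 | rewrite invr_ge0 ].

(** * Sharp two-sided bounds for the supremum, and the closed formula *)

Section ConditionNumber.
Context {R : realType}.
Local Notation C := R[i].

(* The bordered matrix [M + (D x)(w D)] is invertible, and its inverse is the
   required [G]. *)
Lemma pseudo_inverse n (M D : 'M[C]_n) (w : 'rV[C]_n) (x : 'cV[C]_n) :
  w *m M = 0 -> M *m x = 0 -> (forall v, M *m v = 0 -> exists c, v = c *: x) ->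
  (w *m D *m x) 0 0 != 0 ->
  exists G : 'M[C]_n,
    (forall v : 'cV[C]_n,
       v = ((w *m D *m v) 0 0 / (w *m D *m x) 0 0) *: x + G *m (M *m v))
    /\ (forall g : 'cV[C]_n, w *m g = 0 -> M *m (G *m g) = g).
Proof.
set b := (w *m D *m x) 0 0 => wM Mx kerM b0.
pose B := M + D *m x *m (w *m D).
have wB (v : 'cV_n) : w *m (B *m v) = b *: (w *m D *m v).
  rewrite mulmxDl mulmxDr mulmxA wM mul0mx add0r !mulmxA.
  by rewrite -!(mulmxA (w *m D *m x)) [w *m D *m x]mx11_scalar -/b mul_scalar_mx.
have f0 (v : 'cV_n) : b *: (w *m D *m v) = 0 -> w *m D *m v = 0.
  by move/eqP; rewrite scaler_eq0 (negbTE b0) => /eqP.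
have Bv (v : 'cV_n) : B *m v = M *m v + (w *m D *m v) 0 0 *: (D *m x).
  rewrite mulmxDl -[D *m x *m _ *m v]mulmxA.
  by rewrite [X in D *m x *m X]mx11_scalar mul_mx_scalar.
(* Injectivity is tested on the transpose, [inj_row_free] being about rows. If [B v = 0], applying
   [w] gives [w D v = 0], hence [M v = 0] and [v = c x]; then [c b = 0] forces [c = 0]. *)
have uB : B \in unitmx.
  rewrite -unitmx_tr -row_free_unit; apply/inj_row_free => u uB.
  apply: trmx_inj; rewrite trmx0; set v := u^T.
  have Bv0 : B *m v = 0 by apply: trmx_inj; rewrite trmx_mul trmxK uB trmx0.
  have fv : w *m D *m v = 0 by apply: f0; rewrite -wB Bv0 mulmx0.
  have Mv : M *m v = 0.
    by have := Bv v; rewrite Bv0 fv mxE scale0r addr0.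
  have [c vE] := kerM _ Mv; move: fv; rewrite vE -scalemxAr => fv.
  have := congr1 (fun A : 'M[C]_1 => A 0 0) fv; rewrite [LHS]mxE [RHS]mxE -/b.
  by move/eqP; rewrite mulf_eq0 (negbTE b0) orbF => /eqP ->; rewrite scale0r.
exists (invmx B); split => [v|g wg].
  have Bx : B *m x = b *: (D *m x) by rewrite Bv Mx add0r.
  have -> : M *m v = B *m (v - ((w *m D *m v) 0 0 / b) *: x).
    by rewrite mulmxBr -scalemxAr Bx scalerA divfK // Bv addrK.
  by rewrite mulKmx // addrC subrK.
have Bg : B *m (invmx B *m g) = g by rewrite mulKVmx.
have fG : w *m D *m (invmx B *m g) = 0 by apply: f0; rewrite -wB Bg.
by have := Bv (invmx B *m g); rewrite Bg fG mxE scale0r addr0.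
Qed.

Section Estimates.
Context {d n : nat}.
Variables (Q : matpoly R d n) (delta : C) (w : 'rV[C]_n) (x : 'cV[C]_n).
Hypotheses (delta0 : delta != 0)
  (wQ : w *m mpeval Q delta = 0) (Qx : mpeval Q delta *m x = 0)
  (kerQ : forall v, mpeval Q delta *m v = 0 -> exists c, v = c *: x)
  (b0 : (w *m mpderiv Q delta *m x) 0 0 != 0)
  (S0 : 0 < mpweight Q delta).

Let b := (w *m mpderiv Q delta *m x) 0 0.
Let beta := normc b.
Let S := mpweight Q delta.
Let nx := vnorm2 x.
Let nw := vnorm2 w^T.
Let dd := normc delta.

Let beta_gt0 : 0 < beta. Proof. by rewrite normc_gt0. Qed.
Let nx_gt0 : 0 < nx.
Proof.
rewrite vnorm2_gt0; apply: contraNneq b0 => ->.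
by rewrite mulmx0 mxE.
Qed.
Let nw_gt0 : 0 < nw.
Proof.
rewrite vnorm2_gt0; apply: contraNneq b0 => /(congr1 trmx).
by rewrite trmxK trmx0 => ->; rewrite !mul0mx mxE.
Qed.
Let dd_gt0 : 0 < dd. Proof. by rewrite normc_gt0. Qed.

(** Two passes over the equation multiplied by [w], which loses its term [Q(delta) v]. The first
    uses only that [dx] is small and yields [|h| <= Kh eps]. Then [Q(delta) v] is of order [eps], so
    [v] is a multiple of [x] up to order [eps], and the second pass replaces [|v| / |w Q'(delta) v|]
    by [|x| / beta]. The constants [K] and [e0] do not depend on [r]. *)
Lemma rel_changes_upper :
  exists r0 K e0 : R, [/\ 0 < r0, 0 <= K, 0 < e0 &
    forall r eps t, r <= r0 -> 0 < eps -> eps <= e0 ->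
      rel_changes Q delta x r eps t ->
      t <= nw * (S + K * eps) * (nx + K * eps) / (dd * (beta - K * eps))].
Proof.
have bgt := beta_gt0; have xgt := nx_gt0; have wgt := nw_gt0.
have [G [HG _]] := pseudo_inverse wQ Qx kerQ b0.
have [K1 K10 HK1] := mpweight_lipschitz Q delta.
have [K2 K20 HK2] := mpeval_taylor Q delta.
have [D0 D00 HD0] := vnorm2_mulmx_bound (mpderiv Q delta).
have [g g0 Hg] := vnorm2_mulmx_bound G.
(* [Kh] bounds [|h| / eps]: half of [beta] survives in [|w Q'(delta) v|], a quarter absorbs the
   quadratic term, and [|v| <= 2 nx], whence the 8. [K3] bounds [|Q(delta) v| / eps], and [K4]
   bounds the part of [v] off the line of [x], relative to [eps] and to the factor [f >= 1/2]
   below. *)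
pose Kh := 8 * nw * (S + K1) * nx / beta.
pose K3 := (Kh * D0 + K2 * Kh + (S + K1)) * (2 * nx).
pose K4 := 2 * g * K3.
pose K := nw * (K2 * Kh) * (nx + K4) + K1 * Kh + K4.
have SK1 : 0 <= S + K1 by nonneg.
have Kh0 : 0 <= Kh by nonneg.
have K30 : 0 <= K3 by nonneg.
have K40 : 0 <= K4 by nonneg.
have K0 : 0 <= K by nonneg.
(* In order: validity of the Taylor bounds, [|v| <= 2 nx], [|w Q'(delta) v| >= beta / 2], and
   absorption of the quadratic term. The added 1s keep the denominators positive. *)
pose r0 := Num.min 1 (Num.min nx (Num.min (beta / (4 * (nw * D0 + 1)))
   (beta / (8 * (nw * K2 * nx + 1))))).
pose e0 := Num.min 1 (beta / (2 * (K + 1))).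
exists r0, K, e0; split => //.
- rewrite /r0 !lt_min ltr01 nx_gt0 /= !divr_gt0 // mulr_gt0 // ltr_wpDl //; nonneg.
- rewrite /e0 lt_min ltr01 divr_gt0 // mulr_gt0 // ltr_wpDl //.
move=> r eps t rr0 eps0 ee0 [h [dx [dQ [[hr dxr] v0 Hv HdQ ->]]]].
have [r1 rnx rb1 rb2] : [/\ r <= 1, r <= nx, r <= beta / (4 * (nw * D0 + 1)) &
    r <= beta / (8 * (nw * K2 * nx + 1))].
  by move: rr0; rewrite /r0 !le_min => /and4P[].
have [e1 eb] : eps <= 1 /\ eps <= beta / (2 * (K + 1)).
  by move: ee0; rewrite /e0 le_min => /andP[].
have h1 : normc h <= 1 by exact: le_trans r1.
have [E QE HE] := HK2 h h1.
set v := x + dx in v0 Hv; have vE : v = x + dx by []; clearbody v.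
set Eh := mpeval dQ (delta + h) in Hv.
set a := normc h.
have a0 : 0 <= a by exact: normc_ge0.
have Sh : mpweight Q (delta + h) <= S + K1 * a.
  exact: ler_distlDr (HK1 h h1).
have HEv : vnorm2 (Eh *m v) <= eps * (S + K1 * a) * vnorm2 v.
  apply: (le_trans (vnorm2_mpeval _ _ _)); rewrite ler_wpM2r ?vnorm2_ge0 //.
  apply: (@le_trans _ _ (eps * mpweight Q (delta + h))); last by rewrite ler_wpM2l // ltW.
  rewrite mulr_sumr; apply: ler_sum => i _.
  by rewrite mulrCA ler_wpM2l ?exprn_ge0 ?normc_ge0.
have nv : vnorm2 v <= 2 * nx.
  rewrite vE (le_trans (vnorm2D _ _)) // mulr_natl mulr2n lerD2l.
  exact: le_trans dxr rnx.
have nv0 : 0 <= vnorm2 v by exact: vnorm2_ge0.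
set fv := (w *m mpderiv Q delta *m v) 0 0.
have Hfv : beta / 2 <= normc fv.
  have -> : fv = b - (w *m mpderiv Q delta *m (- dx)) 0 0.
    by rewrite /fv vE mulmxDr mulmxN mxE [X in _ - X]mxE opprK.
  set y := (w *m mpderiv Q delta *m (- dx)) 0 0.
  have H1 : normc y <= nw * (D0 * r).
    rewrite /y -mulmxA (le_trans (normc_mul_le _ _)) // ler_wpM2l ?(ltW wgt) //.
    by rewrite (le_trans (HD0 _)) // vnorm2N ler_wpM2l.
  have H2 : nw * (D0 * r) <= beta / 4.
    move: rb1; rewrite ler_pdivlMr ?mulr_gt0 ?ltr_wpDl //; try by nonneg.
    have : 0 <= r by exact: le_trans hr.
    nra.
  apply: le_trans (normc_sub_le b y); rewrite -/beta; lra.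
have Q0v : mpeval Q delta *m v = - (h *: (mpderiv Q delta *m v) + E *m v + Eh *m v).
  move: Hv; rewrite QE !mulmxDl -scalemxAl => /eqP.
  by rewrite -!addrA addr_eq0 => /eqP.
(* Multiplication by [w] on the left removes [Q(delta) v] and leaves a scalar equation for [h]. *)
have main : a * normc fv <= nw * (K2 * a ^+ 2 + eps * (S + K1 * a)) * vnorm2 v.
  have : h * fv = - (w *m (E *m v + Eh *m v)) 0 0.
    have H : - (h *: (w *m mpderiv Q delta *m v) + w *m (E *m v + Eh *m v)) = 0.
      rewrite -mulmxA scalemxAr -mulmxDr -mulmxN addrA -Q0v mulmxA wQ.
      exact: mul0mx.
    move/eqP: H; rewrite oppr_eq0 addr_eq0 => /eqP H.
    by have := congr1 (fun u : 'M[C]_1 => u 0 0) H; rewrite [LHS]mxE [RHS]mxE.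
  move/(congr1 (@normc R)); rewrite normcM normcN => ->.
  apply: (le_trans (normc_mul_le _ _)); rewrite -/nw -mulrA ler_wpM2l //; first exact: ltW.
  apply: (le_trans (vnorm2D _ _)); rewrite mulrDl lerD //; exact: HE.
have aK : a <= Kh * eps.
  have H1 : nw * (K2 * a ^+ 2) * vnorm2 v <= a * (beta / 4).
    have H2 : nw * (K2 * a) * (2 * nx) <= beta / 4.
      have : r * (8 * (nw * K2 * nx + 1)) <= beta.
        rewrite -ler_pdivlMr // mulr_gt0 // ltr_wpDl //; nonneg.
      have : a * (nw * K2 * nx) <= r * (nw * K2 * nx).
        rewrite ler_wpM2r //; nonneg.
      have : 0 <= r by exact: le_trans hr.
      nra.
    apply: (@le_trans _ _ (a * (nw * (K2 * a) * (2 * nx)))); last by rewrite ler_wpM2l.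
    rewrite (_ : nw * _ * _ = a * (nw * (K2 * a) * vnorm2 v)); last by ring.
    rewrite ler_wpM2l // ler_wpM2l //; nonneg.
  have H3 : nw * (eps * (S + K1 * a)) * vnorm2 v <= nw * (eps * (S + K1)) * (2 * nx).
    apply: ler_pM => //; try by nonneg.
    rewrite ler_wpM2l ?(ltW nw_gt0) // ler_wpM2l ?(ltW eps0) // lerD2l.
    by rewrite ler_piMr.
  have H4 : a * (beta / 2) <= a * normc fv by rewrite ler_wpM2l.
  rewrite /Kh mulrAC ler_pdivlMr //.
  move: main; rewrite mulrDr mulrDl; lra.
(* By [HG], [G (Q(delta) v)] is the difference between [v] and its multiple of [x]. *)
have HGv : vnorm2 (G *m (mpeval Q delta *m v)) <= g * (K3 * eps).
  apply: (le_trans (Hg _)); rewrite ler_wpM2l // Q0v vnorm2N.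
  apply: (le_trans (vnorm2D _ _)).
  have H1 : vnorm2 (h *: (mpderiv Q delta *m v) + E *m v) <=
     (Kh * eps * D0 + K2 * (Kh * eps)) * vnorm2 v.
    apply: (le_trans (vnorm2D _ _)); rewrite vnorm2Z mulrDl lerD //.
      by rewrite -mulrA; apply: ler_pM; rewrite ?normc_ge0 ?vnorm2_ge0.
    apply: (le_trans (HE v)); rewrite ler_wpM2r // ler_wpM2l //.
    by apply: le_trans aK; rewrite -/a expr2 ler_piMl.
  have H2 : vnorm2 (Eh *m v) <= eps * (S + K1) * vnorm2 v.
    apply: (le_trans HEv); rewrite ler_wpM2r // ler_wpM2l ?(ltW eps0) // lerD2l.
    by rewrite ler_piMr.
  apply: (le_trans (lerD H1 H2)); rewrite -mulrDl /K3.
  rewrite (_ : _ * (2 * nx) * eps = ((Kh * eps * D0 + K2 * (Kh * eps)) +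
    eps * (S + K1)) * (2 * nx)); last by ring.
  by rewrite ler_wpM2l //; nonneg.
have nfv : 0 < normc fv by apply: lt_le_trans Hfv; rewrite divr_gt0.
set f := normc fv / beta.
have f12 : 1 / 2 <= f by rewrite /f ler_pdivlMr // mulrC mulrA mulr1.
have f0 : 0 < f by rewrite divr_gt0.
(* The factor [f] is put on the error term too, at the cost of the 2 in [K4], so that it cancels
   against [|w Q'(delta) v| = f beta] in the next estimate. *)
have nvf : vnorm2 v <= f * (nx + K4 * eps).
  rewrite [v in vnorm2 v]HG; apply: (le_trans (vnorm2D _ _)).
  rewrite vnorm2Z normcM normcV -/fv -/b -/beta -/f -/nx mulrDr lerD2l.
  apply: (le_trans HGv); rewrite /K4.
  have : 0 <= g * (K3 * eps) by nonneg.
  nra.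
have main2 : a * beta <= nw * (K2 * a ^+ 2 + eps * (S + K1 * a)) * (nx + K4 * eps).
  rewrite -(ler_pM2l f0).
  have -> : f * (a * beta) = a * normc fv by rewrite /f; field; rewrite gt_eqF.
  apply: (le_trans main); rewrite [leRHS]mulrCA ler_wpM2l //.
  by nonneg.
have KE : K * eps < beta.
  move: eb; rewrite ler_pdivlMr ?mulr_gt0 ?ltr_wpDl //.
  have : 0 <= K * eps by nonneg.
  nra.
rewrite ler_pdivrMr ?mulr_gt0 // mulrAC ler_pdivlMr ?mulr_gt0 ?subr_gt0 //.
rewrite (_ : _ * (eps * dd) = (nw * eps * (S + K * eps) * (nx + K * eps)) * dd);
  last by ring.
rewrite mulrCA mulrC ler_pM2r // mulrBr lerBlDr.
apply: (le_trans main2).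
have s0 : S + K1 * a <= S + K * eps.
  rewrite lerD2l; apply: (@le_trans _ _ (K1 * Kh * eps)); first by rewrite -mulrA ler_wpM2l.
  rewrite ler_wpM2r ?(ltW eps0) // /K -addrA addrCA ler_wpDr //; nonneg.
have s1 : nx + K4 * eps <= nx + K * eps.
  rewrite lerD2l ler_wpM2r ?(ltW eps0) // /K ler_wpDl //; nonneg.
rewrite [leLHS](_ : _ = nw * eps * (S + K1 * a) * (nx + K4 * eps) +
  nw * (K2 * a ^+ 2) * (nx + K4 * eps)); last by ring.
apply: lerD.
  apply: ler_pM => //.
  + by nonneg.
  + by nonneg.
  + by rewrite ler_wpM2l // mulr_ge0 // ltW.
apply: (@le_trans _ _ (a * (nw * (K2 * Kh) * (nx + K4) * eps))).
  rewrite (_ : nw * _ * _ = a * (nw * (K2 * a) * (nx + K4 * eps))); last by ring.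
  rewrite ler_wpM2l //.
  rewrite (_ : nw * (K2 * Kh) * (nx + K4) * eps =
    nw * (K2 * (Kh * eps)) * (nx + K4)); last by ring.
  apply: ler_pM.
  + by nonneg.
  + by nonneg.
  + by rewrite ler_wpM2l ?(ltW nw_gt0) // ler_wpM2l.
  + by rewrite lerD2l ler_piMr.
rewrite ler_wpM2l // ler_wpM2r ?(ltW eps0) // /K -addrA ler_wpDr //.
by nonneg.
Qed.

(* To first order the perturbed eigenvector [x + h w0] is chosen so that the
   residual is parallel to [w^*]; this is what makes the bound sharp. *)
Lemma rel_changes_lower :
  exists2 K, 0 <= K & forall r, 0 < r -> exists2 e0, 0 < e0 &
    forall eps, 0 < eps -> eps <= e0 ->
      rel_changes Q delta x r eps
        ((nx - K * eps) * (S - K * eps) / (dd * (beta / nw + K * eps))).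
Proof.
have bgt := beta_gt0; have xgt := nx_gt0; have wgt := nw_gt0; have dgt := dd_gt0.
have [G [_ HG]] := pseudo_inverse wQ Qx kerQ b0.
have [K1 K10 HK1] := mpweight_lipschitz Q delta.
have [K2 K20 HK2] := mpeval_taylor Q delta.
pose y := (map_mx (@conjc R) w)^T.
have nyE : vnorm2 y = nw.
  by rewrite /nw /vnorm2; congr Num.sqrt; apply: eq_bigr => i _; rewrite !mxE normc_conj.
have wy : (w *m y) 0 0 = (nw ^+ 2)%:C.
  rewrite -vnorm2_sqr_mul !mxE; apply: eq_bigr => i _.
  by rewrite !mxE mulrC.
have nwC : (nw ^+ 2)%:C != 0 :> C.
  by rewrite -normc_eq0 normc_real ?sqr_ge0 // sqrf_eq0 gt_eqF.
(* The value of [alpha] makes [w g = 0], the condition under which [Q(delta) w0 = g] is solvable.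
   The residual at [x + h w0] is then [h alpha y] up to order [h^2], of norm about [h beta / nw]. *)
pose alpha : C := b / (nw ^+ 2)%:C.
have nalpha : normc alpha * nw = beta / nw.
  rewrite normcM normcV normc_real ?sqr_ge0 // -/beta; field; rewrite gt_eqF //.
pose g := alpha *: y - mpderiv Q delta *m x.
have wg : w *m g = 0.
  rewrite mulmxBr -scalemxAr mulmxA [w *m y]mx11_scalar wy.
  rewrite [w *m _ *m x]mx11_scalar -/b -scalemx1 scalerA divfK // scalemx1.
  exact: subrr.
set w0 := G *m g; have Qw0 : mpeval Q delta *m w0 = g by exact: HG.
clearbody w0.
have [D1 [D10 HD1]] : exists c, 0 <= c /\ vnorm2 (mpderiv Q delta *m w0) <= c.
  by exists (vnorm2 (mpderiv Q delta *m w0)); rewrite vnorm2_ge0.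
have [n0 [n00 Hn0]] : exists c, 0 <= c /\ vnorm2 w0 <= c.
  by exists (vnorm2 w0); rewrite vnorm2_ge0.
pose B := beta / nw.
have B0 : 0 < B by rewrite divr_gt0.
pose K3 := D1 + K2 * (nx + n0).
pose Kh := nx * S / B.
pose K := (K3 + n0 + K1) * Kh.
have K30 : 0 <= K3 by nonneg.
have Kh0 : 0 <= Kh by nonneg.
have K0 : 0 <= K by nonneg.
exists K => // r r0.
(* The first two terms keep [nx - K eps] and [S - K eps] positive, the third gives [h <= 1], and the
   last two put [h] and [h w0] within the radius [r]. *)
pose e0 := Num.min (nx / (2 * (K + 1))) (Num.min (S / (2 * (K + 1)))
  (Num.min (1 / (Kh + 1)) (Num.min (r / (Kh + 1)) (r / (Kh * n0 + 1))))).
have Khn0 : 0 <= Kh * n0 by nonneg.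
exists e0.
  by rewrite /e0 !lt_min !divr_gt0 // ?mulr_gt0 // ltr_wpDl.
move=> eps eps0; rewrite /e0 !le_min.
rewrite !ler_pdivlMr ?mulr_gt0 ?ltr_wpDl // => /and5P[ex eS eh er en].
have Ke0 : 0 <= K * eps by nonneg.
have xK : 0 < nx - K * eps by nra.
have SK : 0 < S - K * eps by nra.
(* Chosen so that [h (B + K eps)], an upper bound for the residual, equals
   [eps (nx - K eps) (S - K eps)], a lower bound for the residual that perturbations of level [eps]
   can cancel. *)
pose h := eps * ((nx - K * eps) * (S - K * eps) / (B + K * eps)).
have BK : 0 < B + K * eps by rewrite ltr_wpDr.
have h0 : 0 < h by rewrite /h mulr_gt0 // divr_gt0 // mulr_gt0.
have hKh : h <= Kh * eps.
  rewrite /h mulrC ler_wpM2r ?(ltW eps0) // /Kh.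
  apply: ler_pM; rewrite ?invr_ge0 ?mulr_ge0 ?(ltW BK) ?(ltW xK) ?(ltW SK) //.
    by apply: ler_pM; rewrite ?(ltW xK) ?(ltW SK) // gerBl.
  by rewrite lef_pV2 ?posrE // lerDl.
have h1 : h <= 1 by nra.
have hr : h <= r by nra.
have hn : h * n0 <= r.
  apply: (@le_trans _ _ (Kh * eps * n0)); first by rewrite ler_wpM2r.
  nra.
have nh : normc (h%:C) = h by rewrite normc_real // ltW.
have nh1 : normc (h%:C) <= 1 by rewrite nh.
have [E QE HE] := HK2 _ nh1; rewrite nh in HE.
set z := delta + h%:C in QE.
pose v := x + h%:C *: w0.
have Sz : S - K1 * h <= mpweight Q z.
  by have /ler_normlP[H _] := HK1 _ nh1; move: H; rewrite -/S -/z nh; lra.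
have nv1 : vnorm2 v <= nx + n0.
  apply: (le_trans (vnorm2D _ _)); rewrite vnorm2Z nh lerD2l.
  by apply: le_trans Hn0; rewrite ler_piMl ?vnorm2_ge0.
have nv2 : nx - h * n0 <= vnorm2 v.
  have := vnorm2_sub_le x (- (h%:C *: w0)).
  rewrite opprK vnorm2N vnorm2Z nh; apply: le_trans.
  by rewrite lerD2l lerN2 ler_wpM2l // ltW.
have KhK (c : R) : 0 <= c -> c <= K3 + n0 + K1 -> c * h <= K * eps.
  move=> c0 cK; rewrite /K -mulrA.
  by apply: ler_pM => //; exact: ltW.
have nv3 : nx - K * eps <= vnorm2 v.
  apply: le_trans nv2; rewrite lerD2l lerN2 mulrC KhK //; lra.
have Sz2 : S - K * eps <= mpweight Q z.
  by apply: le_trans Sz; rewrite lerD2l lerN2 KhK //; lra.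
have Qv : mpeval Q z *m v =
    h%:C *: (alpha *: y + h%:C *: (mpderiv Q delta *m w0)) + E *m v.
  rewrite QE !mulmxDl; congr (_ + _).
  rewrite [in X in X + _]/v mulmxDr Qx add0r -scalemxAr Qw0 /g -scalemxAl -scalerDr.
  by rewrite /v mulmxDr -scalemxAr addrA subrK.
have res : vnorm2 (mpeval Q z *m v) <= h * (B + K3 * h).
  rewrite Qv; apply: (le_trans (vnorm2D _ _)); rewrite vnorm2Z nh.
  apply: (@le_trans _ _ (h * (B + h * D1) + K2 * h ^+ 2 * (nx + n0))).
    apply: lerD; last first.
      by apply: (le_trans (HE v)); rewrite ler_wpM2l //; nonneg.
    rewrite ler_wpM2l ?(ltW h0) //; apply: (le_trans (vnorm2D _ _)).
    by rewrite !vnorm2Z nh nyE nalpha lerD2l ler_wpM2l // ltW.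
  by rewrite le_eqVlt; apply/orP; left; apply/eqP; rewrite /K3; ring.
have v0 : v != 0 by rewrite -vnorm2_gt0; apply: lt_le_trans nv3.
have res2 : vnorm2 (mpeval Q z *m v) <= eps * (mpweight Q z * vnorm2 v).
  apply: (le_trans res); apply: (@le_trans _ _ (h * (B + K * eps))).
    by rewrite ler_wpM2l ?(ltW h0) // lerD2l KhK //; lra.
  rewrite {1}/h -mulrA divfK ?gt_eqF // ler_wpM2l ?(ltW eps0) // mulrC.
  by apply: ler_pM; rewrite ?(ltW xK) ?(ltW SK).
have [dQ HdQ1 HdQ2] := backward_perturbation v0 (lt_le_trans SK Sz2) res2.
exists h%:C, (h%:C *: w0), dQ; split => //.
- rewrite nh vnorm2Z nh; split => //; apply: le_trans hn.
  by rewrite ler_wpM2l // ltW.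
- rewrite nh /h -/B -/dd; field.
  by rewrite !gt_eqF.
Qed.

(** The lower bound is an element of the set and the upper one bounds it, so [sup] is a true
    supremum. Its limit in [eps] is already the claimed value for each [r <= r0]; the outer limit is
    that of an eventually constant function. *)
Theorem condnumE : condnum Q delta x = S * nw * nx / (dd * beta).
Proof.
have bgt := beta_gt0; have xgt := nx_gt0; have wgt := nw_gt0; have dgt := dd_gt0.
have [r0 [K [e0 [r0gt K0 e0gt HU]]]] := rel_changes_upper.
have [K' K'0 HL] := rel_changes_lower.
set kappa := RHS.
have idc : (fun e : R => e) @ 0^'+ --> (0 : R) by exact: cvg_at_right_filter.
have Uc : (nw * (S + K * e) * (nx + K * e) / (dd * (beta - K * e)))
    @[e --> 0^'+] --> kappa.
  have Kc : (K * e) @[e --> 0^'+] --> (0 : R).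
    by rewrite -[X in _ --> X](mulr0 K); apply: cvgM => //; exact: cvg_cst.
  have -> : kappa = nw * (S + 0) * (nx + 0) / (dd * (beta - 0)).
    by rewrite /kappa !addr0 subr0 (mulrC S).
  apply: cvgM.
    apply: cvgM; first apply: cvgM; try exact: cvg_cst.
      by apply: cvgD => //; exact: cvg_cst.
    by apply: cvgD => //; exact: cvg_cst.
  apply: cvgV; first by rewrite subr0 gt_eqF // mulr_gt0.
  apply: cvgM; first exact: cvg_cst.
  by apply: cvgB => //; exact: cvg_cst.
have Lc : ((nx - K' * e) * (S - K' * e) / (dd * (beta / nw + K' * e)))
    @[e --> 0^'+] --> kappa.
  have Kc : (K' * e) @[e --> 0^'+] --> (0 : R).
    by rewrite -[X in _ --> X](mulr0 K'); apply: cvgM => //; exact: cvg_cst.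
  have -> : kappa = (nx - 0) * (S - 0) / (dd * (beta / nw + 0)).
    rewrite /kappa !subr0 addr0; field; rewrite !gt_eqF //.
  apply: cvgM.
    apply: cvgM.
      by apply: cvgB => //; exact: cvg_cst.
    by apply: cvgB => //; exact: cvg_cst.
  apply: cvgV; first by rewrite addr0 gt_eqF // mulr_gt0 // divr_gt0.
  apply: cvgM; first exact: cvg_cst.
  by apply: cvgD => //; exact: cvg_cst.
have lim_eps r : 0 < r -> r <= r0 ->
    lim (sup (rel_changes Q delta x r eps) @[eps --> 0^'+]) = kappa.
  move=> rgt rle; have [e1 e1gt HL1] := HL r rgt.
  apply: cvg_lim => //; apply: squeeze_cvgr Lc Uc.
  near=> e.
  have e_gt0 : 0 < e by near: e; exact: nbhs_right_gt.
  have ee0 : e <= e0 by near: e; exact: nbhs_right_le.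
  have ee1 : e <= e1 by near: e; exact: nbhs_right_le.
  have ub : ubound (rel_changes Q delta x r e)
    (nw * (S + K * e) * (nx + K * e) / (dd * (beta - K * e))).
    by move=> t; exact: HU.
  apply/andP; split; first by apply: ub_le_sup; [eexists; exact: ub|exact: HL1].
  by apply: ge_sup => //; eexists; exact: HL1.
rewrite /condnum; apply: cvg_lim => //.
apply: cvg_near_cst; near=> r; apply: lim_eps.
  by near: r; exact: nbhs_right_gt.
by near: r; exact: nbhs_right_le.
Unshelve. all: by end_near.
Qed.

End Estimates.
End ConditionNumber.

(** * Simple eigenvalues *)

Section SimpleEigenvalue.
Context {R : realType}.
Local Notation C := R[i].

(** A nonzero entry in row [i] of the adjugate is an invertible minor of [M] that omits column [i].
    Subtracting a multiple of [x] clears entry [i] of [v], and the minor then forces the other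
    entries to vanish. *)
Lemma adj_row_neq0_kernel n (M : 'M[C]_n) (x v : 'cV[C]_n) i :
  x i 0 != 0 -> row i (\adj M) != 0 -> M *m x = 0 -> M *m v = 0 ->
  exists c, v = c *: x.
Proof.
move=> xi wi Mx Mv; exists (v i 0 / x i 0).
set c := _ / _; apply/eqP; rewrite -subr_eq0; apply/eqP.
set u := v - c *: x.
have ui : u i 0 = 0 by rewrite !mxE /c divfK // subrr.
have Mu : M *m u = 0 by rewrite mulmxBr -scalemxAr Mx Mv scaler0 subr0.
clearbody u.
have [j wj] : exists j, cofactor M j i != 0.
  apply/existsP; apply: contraNT wi => /existsPn H.
  by apply/eqP/rowP => j; rewrite !mxE; apply/eqP; rewrite -[_ == _]negbK H.
have uM : row' j (col' i M) \in unitmx.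
  rewrite unitmxE unitfE; apply: contraNneq wj => d0.
  by rewrite /cofactor d0 mulr0.
have Mu' : row' j (col' i M) *m row' i u = 0.
  apply/colP => l; rewrite mxE [RHS]mxE.
  have := congr1 (fun A : 'cV[C]_n => A (lift j l) 0) Mu.
  rewrite /= [LHS]mxE [RHS]mxE (bigD1_ord i) //= ui mulr0 add0r => H.
  by rewrite -[RHS]H; apply: eq_bigr => m _; rewrite !mxE.
have u0 : row' i u = 0 by rewrite -(mulKmx uM (row' i u)) Mu' mulmx0.
apply/colP => l; rewrite [RHS]mxE.
case: (unliftP i l) => [m ->|-> //].
by have := congr1 (fun A : 'cV[C]_n.-1 => A m 0) u0; rewrite /= !mxE.
Qed.

(** With [x i 0] nonzero, [w] is row [i] of the adjugate of [Q(delta)]. Differentiating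
    [adj Q * Q * x = det Q * x] at [delta], where [Q x] vanishes, gives
    [w Q'(delta) x = (det Q)'(delta) x_i], nonzero at a simple root. In particular [w] is nonzero,
    so the kernel is a line. *)
Lemma simple_eigenvalue_left d n (Q : matpoly R d n) delta (x : 'cV[C]_n) :
  regular Q -> simple_eigenvalue Q delta -> right_eigvec Q delta x ->
  exists w : 'rV[C]_n, [/\ w *m mpeval Q delta = 0,
    (w *m mpderiv Q delta *m x) 0 0 != 0 &
    forall v, mpeval Q delta *m v = 0 -> exists c, v = c *: x].
Proof.
move=> reg simp [x0 Qx].
pose PQ : 'M[{poly C}]_n := \sum_(i < d.+1) 'X^i *: map_mx polyC (Q i).
have PQE k l : PQ k l = \sum_(i < d.+1) 'X^i * (Q i k l)%:P.
  by rewrite summxE; apply: eq_bigr => i _; rewrite !mxE.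
have evPQ : map_mx (horner_eval delta) PQ = mpeval Q delta.
  apply/matrixP => k l; rewrite mxE PQE /mpeval summxE /horner_eval horner_sum.
  by apply: eq_bigr => i _; rewrite hornerM hornerXn hornerC !mxE.
have [q detE qd] : exists2 q, mpdet Q = q * ('X - delta%:P) & q.[delta] != 0.
  have : 'X - delta%:P %| mpdet Q by rewrite XsubC_dvd // simp.
  case/dvdpP => q qE; exists q => //.
  have q0 : q != 0 by apply: contraNneq reg => q0; rewrite qE q0 mul0r.
  have := simp; rewrite /simple_eigenvalue qE mupM ?polyXsubC_eq0 //.
  rewrite -['X - _]expr1 mup_XsubCX eqxx.
  rewrite addn1 => -[] /eqP; apply: contraTT.
  by rewrite negbK -lt0n -XsubC_dvd // dvdp_XsubCl.
have det0 : (mpdet Q).[delta] = 0 by rewrite detE hornerM hornerXsubC subrr mulr0.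
have ddet : (mpdet Q)^`().[delta] != 0.
  rewrite detE derivM derivXsubC hornerD !hornerM hornerXsubC subrr mulr0 add0r.
  by rewrite hornerC mulr1.
have [i xi] : exists i, x i 0 != 0.
  apply/existsP; apply: contraNT x0 => /existsPn H.
  by apply/eqP/colP => j; rewrite mxE; apply/eqP; rewrite -[_ == _]negbK H.
have adjE : map_mx (horner_eval delta) (\adj PQ) = \adj (mpeval Q delta).
  by rewrite -evPQ map_mx_adj.
exists (row i (\adj (mpeval Q delta))).
have wQx : (row i (\adj (mpeval Q delta)) *m mpderiv Q delta *m x) 0 0 =
   (mpdet Q)^`().[delta] * x i 0.
  have deriv_sum (I : finType) (F : I -> {poly C}) :
    (\sum_j F j)^`() = \sum_j (F j)^`() by exact: raddf_sum.
  pose xP := map_mx (@polyC C) x.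
  have E : (\adj PQ *m (PQ *m xP)) i 0 = mpdet Q * (x i 0)%:P.
    by rewrite mulmxA mul_adj_mx mul_scalar_mx !mxE.
  have Pm m : ((PQ *m xP) m 0).[delta] = (mpeval Q delta *m x) m 0.
    rewrite -evPQ !mxE horner_sum; apply: eq_bigr => l _.
    by rewrite hornerM !mxE hornerC.
  have dPm m : ((PQ *m xP) m 0)^`().[delta] = (mpderiv Q delta *m x) m 0.
    rewrite !mxE deriv_sum horner_sum; apply: eq_bigr => l _.
    rewrite derivM !mxE derivC mulr0 addr0 hornerM hornerC; congr (_ * _).
    rewrite PQE deriv_sum horner_sum /mpderiv summxE; apply: eq_bigr => j _.
    rewrite derivM derivC mulr0 addr0 derivXn hornerM hornerC hornerMn hornerXn !mxE.
    by rewrite mulr_natl.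
  have := congr1 (fun p : {poly C} => p^`().[delta]) E.
  rewrite /= derivM derivC mulr0 addr0 hornerM hornerC => <-.
  rewrite -mulmxA [LHS]mxE [in RHS]mxE deriv_sum horner_sum.
  apply: eq_bigr => m _.
  rewrite derivM hornerD !hornerM Pm Qx [X in _ * X + _]mxE mulr0 add0r dPm.
  by congr (_ * _); rewrite [LHS]mxE -adjE mxE.
split.
- rewrite -row_mul mul_adj_mx.
  have -> : \det (mpeval Q delta) = (mpdet Q).[delta].
    by rewrite -evPQ det_map_mx.
  by rewrite det0 -scalemx1 scale0r row0.
- by rewrite wQx mulf_neq0.
move=> v Qv; apply: (adj_row_neq0_kernel xi _ Qx Qv).
apply: contraNneq (mulf_neq0 ddet xi) => w0.
by rewrite -wQx w0 !mul0mx mxE.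
Qed.

End SimpleEigenvalue.

(** * The first Frobenius companion pencil *)

Section Blocks.
Context {R : realType}.
Local Notation C := R[i].

Lemma vnorm2_sqr_mxcol p (p_ : 'I_p -> nat) (v : forall i, 'cV[C]_(p_ i)) :
  vnorm2 (\mxcol_i v i) ^+ 2 = \sum_i vnorm2 (v i) ^+ 2.
Proof.
apply: (@complexI R); rewrite -vnorm2_sqr_mul rmorph_sum /=.
have -> : map_mx (@conjc R) (\mxcol_i v i)^T = \mxrow_i (map_mx (@conjc R) (v i)^T).
  by apply/matrixP => i j; rewrite !mxE.
by rewrite mul_mxrow_mxcol summxE; apply: eq_bigr => i _; rewrite vnorm2_sqr_mul.
Qed.

Lemma vnorm2_submxcol_le p (p_ : 'I_p -> nat) (v : 'cV[C]_(\sum_i p_ i)) i :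
  vnorm2 (submxcol v i) <= vnorm2 v.
Proof.
rewrite -[X in _ <= X]mul1r; apply: vnorm2_le_sqr; first exact: ler01.
rewrite expr1n mul1r -[v in X in _ <= X]submxcolK vnorm2_sqr_mxcol (bigD1 i) //=.
by rewrite lerDl sumr_ge0 // => j _; rewrite sqr_ge0.
Qed.

Lemma specnorm_submxblock p q m n
    (M : 'M[C]_(\sum_(i < p) m, \sum_(j < q) n)) i j :
  specnorm (submxblock M i j) <= specnorm M.
Proof.
apply: specnorm_le => [|v]; first exact: specnorm_ge0.
pose u := \mxcol_(l < q) (if l == j then v else 0).
have <- : vnorm2 u = vnorm2 v.
  apply: (@pexpIrn _ 2) => //; rewrite ?nnegrE ?vnorm2_ge0 //.
  rewrite vnorm2_sqr_mxcol (bigD1 j) //= eqxx big1 ?addr0 // => l /negbTE ->.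
  by rewrite vnorm20 expr0n.
apply: le_trans (vnorm2_mulmx M u).
suff <- : submxcol (M *m u) i = submxblock M i j *m v by exact: vnorm2_submxcol_le.
rewrite -[M in LHS]submxblockK mul_mxblock_mxrow mxcolK (bigD1 j) //= eqxx.
by rewrite big1 ?addr0 // => l /negbTE ->; rewrite mulmx0.
Qed.

Lemma specnormN m n (M : 'M[C]_(m, n)) : specnorm (- M) = specnorm M.
Proof.
apply/le_anti/andP; split; apply: specnorm_le => [|v];
  rewrite ?specnorm_ge0 //.
  by rewrite mulNmx vnorm2N vnorm2_mulmx.
by rewrite -vnorm2N -mulNmx vnorm2_mulmx.
Qed.

Lemma specnorm1_ge1 n : (0 < n)%N -> 1 <= specnorm (1%:M : 'M[C]_n).
Proof.
case: n => // n _; have /= := vnorm2_mulmx (1%:M : 'M[C]_n.+1) (delta_mx 0 0).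
rewrite mul1mx; set a := vnorm2 _.
have a0 : 0 < a.
  rewrite vnorm2_gt0; apply/negP => /eqP/colP/(_ 0); rewrite !mxE !eqxx => /eqP.
  by rewrite oner_eq0.
by move=> H; rewrite -(ler_pM2r a0) mul1r.
Qed.

End Blocks.

Section DegreeOne.
Context {R : realType} {m : nat}.
Variables (Q : matpoly R 1 m) (z : R[i]).

Let lift01 : lift ord0 ord0 = ord_max :> 'I_2. Proof. exact: val_inj. Qed.

Lemma mpeval_deg1 : mpeval Q z = z *: Q ord_max + Q ord0.
Proof. by rewrite /mpeval big_ord_recl big_ord1 lift01 expr0 scale1r addrC. Qed.

Lemma mpderiv_deg1 : mpderiv Q z = Q ord_max.
Proof.
by rewrite /mpderiv big_ord_recl big_ord1 lift01 mul0r scale0r add0r mulr1 scale1r.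
Qed.

Lemma mpweight_deg1 :
  mpweight Q z = specnorm (Q ord0) + normc z * specnorm (Q ord_max).
Proof. by rewrite /mpweight big_ord_recl big_ord1 lift01 expr0 mul1r. Qed.

End DegreeOne.

Lemma widen_rev_ord_inord k (j : 'I_k.+1) :
  widen_ord (leqnSn k.+1) (rev_ord j) = inord (k - j).
Proof.
apply: val_inj; rewrite /= inordK ?subSS //.
by rewrite ltnS (leq_trans (leq_subr _ _)).
Qed.

(** * Kernels of the companion pencil through Horner shifts *)

Section Frobenius.
Context {R : realType} {k n : nat}.
Local Notation C := R[i].
Variable A : matpoly R k.+1 n.

(** The degree is written [k.+1] in this section. The constant coefficient of a [pencil] is [- L0],
    hence the sign in [L0]. *)
Let L1 : 'M[C]_(\sum_(i < k.+1) n) := frobenius1 A ord_max.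
Let L0 : 'M[C]_(\sum_(i < k.+1) n) := - frobenius1 A ord0.

(** Partial Horner evaluations at [z], from the leading coefficient down: the step from [j'] brings
    in the coefficient of index [k - j'], and [j = k.+1] gives the whole polynomial. *)
Fixpoint horner_shift (z : C) j : 'M[C]_n :=
  if j is j'.+1 then z *: horner_shift z j' + A (inord (k - j')) else A ord_max.

Lemma mpeval_frobenius1 z : mpeval (frobenius1 A) z = z *: L1 - L0.
Proof. by rewrite mpeval_deg1 opprK. Qed.

Lemma mpderiv_frobenius1 z : mpderiv (frobenius1 A) z = L1.
Proof. exact: mpderiv_deg1. Qed.

Lemma frobenius1_L1_mxcol (v : 'I_k.+1 -> 'cV[C]_n) :
  L1 *m (\mxcol_i v i) = \mxcol_i (if i == 0 :> nat then A ord_max *m v i else v i).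
Proof.
rewrite /L1 /frobenius1 /pencil /= mul_mxdiag_mxcol; apply: eq_mxcol => i.
by case: ifP => //; rewrite mul1mx.
Qed.

Lemma frobenius1_L0_mxcol (v : 'I_k.+1 -> 'cV[C]_n) :
  L0 *m (\mxcol_i v i) = \mxcol_i (if i == 0 :> nat
    then - \sum_(j < k.+1) A (inord (k - j)) *m v j else v (inord i.-1)).
Proof.
rewrite /L0 /frobenius1 /pencil /= opprK mul_mxblock_mxrow; apply: eq_mxcol => i.
case: ifP => [_|i0].
  rewrite -sumrN; by apply: eq_bigr => j _; rewrite mulNmx widen_rev_ord_inord.
have i1 : (i.-1 < k.+1)%N by rewrite (leq_ltn_trans (leq_pred i)).
rewrite (bigD1 (inord i.-1)) //= inordK // prednK ?lt0n ?i0 // eqxx mul1mx.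
rewrite big1 ?addr0 // => j jN; rewrite ifN ?mul0mx //.
apply: contra jN => /eqP e; apply/eqP/val_inj; rewrite /= inordK //.
by rewrite e.
Qed.

Lemma mxrow_frobenius1_L1 (w : 'I_k.+1 -> 'rV[C]_n) :
  (\mxrow_i w i) *m L1 = \mxrow_i (if i == 0 :> nat then w i *m A ord_max else w i).
Proof.
rewrite /L1 /frobenius1 /pencil /= mul_mxrow_mxdiag; apply: eq_mxrow => i.
by case: ifP => //; rewrite mulmx1.
Qed.

Lemma mxrow_frobenius1_L0 (w : 'I_k.+1 -> 'rV[C]_n) :
  (\mxrow_i w i) *m L0 = \mxrow_j (- (w 0 *m A (inord (k - j))) +
    (if (j < k)%N then w (inord j.+1) else 0)).
Proof.
rewrite /L0 /frobenius1 /pencil /= opprK mul_mxrow_mxblock; apply: eq_mxrow => j.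
rewrite big_ord_recl /= mulmxN widen_rev_ord_inord; congr (_ + _).
case: ifP => [jk|jk].
  rewrite (bigD1 (Ordinal jk)) //= eqxx mulmx1 big1 ?addr0.
    by congr w; apply: val_inj; rewrite /= inordK.
  move=> i iN; rewrite ifN ?mulmx0 //; apply: contra iN.
rewrite big1 // => i _; rewrite ifN ?mulmx0 //; apply/negP => /eqP [e].
by move: (ltn_ord i); rewrite -[X in (X < _)%N]add0n e jk.
Qed.

Lemma horner_shiftE z j : (j <= k.+1)%N ->
  horner_shift z j = \sum_(i < j.+1) z ^+ (j - i) *: A (inord (k.+1 - i)).
Proof.
elim: j => [|j IH] jk /=.
  rewrite big_ord1 /= !subn0 expr0 scale1r; congr A; apply: val_inj.
  by rewrite /= inordK.
rewrite IH ?(ltnW jk) // [RHS]big_ord_recr /= subnn expr0 scale1r subSS; congr (_ + _).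
rewrite scaler_sumr; apply: eq_bigr => i _; rewrite scalerA -exprS.
by rewrite (subSn (_ : i <= j)%N) // -ltnS.
Qed.

(** Both sides are the derivative in [z] of [horner_shift z j]. The induction step is the
    differentiated recursion [H_(j+1)' = z H_j' + H_j]. *)
Lemma sum_horner_shift z j : (j <= k.+1)%N ->
  \sum_(i < j) z ^+ (j.-1 - i) *: horner_shift z i =
  \sum_(i < j.+1) ((j - i)%:R * z ^+ (j - i).-1) *: A (inord (k.+1 - i)).
Proof.
elim: j => [|j IH] jk.
  by rewrite big_ord0 big_ord1 subnn mul0r scale0r.
rewrite big_ord_recr /= subnn expr0 scale1r.
have -> : \sum_(i < j) z ^+ (j - i) *: horner_shift z i =
    z *: \sum_(i < j) z ^+ (j.-1 - i) *: horner_shift z i.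
  rewrite scaler_sumr; apply: eq_bigr => i _; rewrite scalerA -exprS.
  by case: j i {IH jk} => [[]//|j i]; rewrite /= subSn // -ltnS.
rewrite IH ?(ltnW jk) // [RHS]big_ord_recr /= subnn mul0r scale0r addr0.
rewrite horner_shiftE ?(ltnW jk) // scaler_sumr -big_split /=; apply: eq_bigr => i _.
rewrite scalerA -scalerDl; congr (_ *: _).
have ij : (i <= j)%N by rewrite -ltnS.
rewrite (subSn ij) /= -natr1; case: (j - i)%N => [|m] /=; first by rewrite expr0; ring.
by rewrite exprS; ring.
Qed.

Lemma horner_shift_mpeval z : horner_shift z k.+1 = mpeval A z.
Proof.
rewrite horner_shiftE // /mpeval (reindex_inj rev_ord_inj) /=.
apply: eq_bigr => i _; rewrite subSS subKn ?leq_ord //.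
by congr (_ *: A _); apply: val_inj; rewrite /= inordK.
Qed.

Lemma sum_horner_shift_mpderiv z :
  \sum_(i < k.+1) z ^+ (k - i) *: horner_shift z i = mpderiv A z.
Proof.
have /= -> := @sum_horner_shift z k.+1 (leqnn _).
rewrite /mpderiv (reindex_inj rev_ord_inj) /=.
apply: eq_bigr => i _; rewrite subSS subKn ?leq_ord //.
by congr (_ *: A _); apply: val_inj; rewrite /= inordK.
Qed.

Definition frobenius1_right (z : C) (x : 'cV[C]_n) : 'cV[C]_(\sum_(i < k.+1) n) :=
  \mxcol_(i < k.+1) (z ^+ (k - i) *: x).

(** Block 0 is [w] and not [w H_0]: the leading coefficient sits in [L1], so multiplication by [L1]
    produces [w H_i] in every block. *)
Definition frobenius1_left (z : C) (w : 'rV[C]_n) : 'rV[C]_(\sum_(i < k.+1) n) :=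
  \mxrow_(i < k.+1) (if i == 0 :> nat then w else w *m horner_shift z i).

(** Block [j < k] of the product is [z w H_j + w A_(k-j) - w H_(j+1)], which vanishes by the
    recursion; the last block is [w P(z)]. *)
Lemma frobenius1_left_eigvec z w : w *m mpeval A z = 0 ->
  frobenius1_left z w *m mpeval (frobenius1 A) z = 0.
Proof.
move=> wA; rewrite mpeval_frobenius1 mulmxBr -scalemxAr /frobenius1_left.
rewrite mxrow_frobenius1_L1 mxrow_frobenius1_L0; apply/mxrowP => j.
rewrite submxrowB submxrow0 (_ : submxrow (z *: _) j = z *: submxrow
  (\mxrow_i (if i == 0 :> nat then (if i == 0 :> nat then w else
    w *m horner_shift z i) *m A ord_max else if i == 0 :> nat then w else
    w *m horner_shift z i)) j); last by apply/matrixP => a b; rewrite !mxE.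
rewrite !mxrowK /=.
have -> : (if j == 0 :> nat then (if j == 0 :> nat then w else
    w *m horner_shift z j) *m A ord_max else if j == 0 :> nat then w else
    w *m horner_shift z j) = w *m horner_shift z j.
  by case: eqP => [->|].

have step : z *: (w *m horner_shift z j) + w *m A (inord (k - j)) =
    w *m horner_shift z j.+1 by rewrite /= mulmxDr scalemxAr.
case: ifP => jk.
  by rewrite inordK //= opprD opprK addrA step subrr.
rewrite addr0 opprK step; have -> : j = k :> nat.
  by apply/eqP; rewrite eqn_leq -ltnS ltn_ord /= leqNgt jk.
by rewrite horner_shift_mpeval.
Qed.

Lemma frobenius1_left_right z w x :
  frobenius1_left z w *m L1 *m frobenius1_right z x = w *m mpderiv A z *m x.
Proof.
rewrite mxrow_frobenius1_L1 mul_mxrow_mxcol -sum_horner_shift_mpderiv.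
rewrite mulmx_sumr mulmx_suml; apply: eq_bigr => i _.
by rewrite -!(scalemxAr, scalemxAl); case: eqP => [->|].
Qed.

(** The lower block rows say that each block is [z] times the next one, so all are powers of [z]
    times the last block [u]. The first block row then reads [P(z) u = 0]. *)
Lemma frobenius1_kernel z (v : 'cV[C]_(\sum_(i < k.+1) n)) :
  mpeval (frobenius1 A) z *m v = 0 ->
  exists2 u, mpeval A z *m u = 0 & v = frobenius1_right z u.
Proof.
pose y (i : 'I_k.+1) : 'cV[C]_n := submxcol v i.
have -> : v = \mxcol_i y i by rewrite submxcolK.
rewrite mpeval_frobenius1 mulmxBl -scalemxAl.
rewrite frobenius1_L1_mxcol frobenius1_L0_mxcol => /eqP; rewrite subr_eq0 => /eqP H.
have Hi (i : 'I_k.+1) : z *: (if i == 0 :> nat then A ord_max *m y i else y i) =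
  if i == 0 :> nat then - \sum_(j < k.+1) A (inord (k - j)) *m y j
  else y (inord i.-1).
  have := congr1 (fun u => submxcol u i) H; rewrite mxcolK => <-.
  set F := (fun i : 'I_k.+1 => if i == 0 :> nat then A ord_max *m y i else y i).
  by rewrite -[LHS]/(z *: F i) -(mxcolK F i); apply/matrixP => a b; rewrite !mxE.
have yE m : (m <= k)%N -> y (inord (k - m)) = z ^+ m *: y ord_max.
  elim: m => [|m IH] mk.
    by rewrite subn0 expr0 scale1r; congr y; apply: val_inj; rewrite /= inordK.
  have := Hi (inord (k - m)); rewrite inordK ?ltnS ?leq_subr //.
  rewrite subn_eq0 leqNgt mk /= -subnS (IH (ltnW mk)).
  by rewrite scalerA -exprS => <-.
have yE' (i : 'I_k.+1) : y i = z ^+ (k - i) *: y ord_max.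
  rewrite -yE ?leq_subr // subKn ?leq_ord //; congr y; apply: val_inj.
  by rewrite /= inordK.
exists (y ord_max); last first.
  by apply: eq_mxcol => i; exact: yE'.
have := Hi 0; rewrite /= => /eqP; rewrite -addr_eq0 => /eqP <-.
rewrite /mpeval big_ord_recr /= mulmxDl addrC; congr (_ + _).
  by rewrite (yE' 0) [(k - _)%N]subn0 -scalemxAr scalerA -exprS -scalemxAl.
rewrite mulmx_suml [RHS](reindex_inj rev_ord_inj) /=; apply: eq_bigr => i _.
rewrite (yE' (rev_ord i)) /= subSS subKn ?leq_ord // -scalemxAl -scalemxAr.
congr (_ *: (A _ *m _)); apply: val_inj; rewrite /= inordK //.
by rewrite ltnW // ltnS.
Qed.

End Frobenius.

(** * Norm bounds for the pencil and its eigenvectors *)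

Section FrobeniusNorms.
Context {R : realType} {k n : nat}.
Local Notation C := R[i].
Variables (A : matpoly R k.+1 n) (M : R).
Hypotheses (k_gt0 : (0 < k)%N) (M_ge1 : 1 <= M)
  (AM : forall i, specnorm (A i) <= M).

Lemma vnorm2_mxcol_le (u v : 'I_k.+1 -> 'cV[C]_n) c : 0 <= c ->
  (forall i, vnorm2 (u i) <= c * vnorm2 (v i)) ->
  vnorm2 (\mxcol_i u i) <= c * vnorm2 (\mxcol_i v i).
Proof.
move=> c0 uv; apply: vnorm2_le_sqr => //.
rewrite !vnorm2_sqr_mxcol mulr_sumr; apply: ler_sum => i _.
by rewrite -exprMn ler_pXn2r ?nnegrE ?mulr_ge0 ?vnorm2_ge0.
Qed.

Lemma specnorm_frobenius1_L1_le : specnorm (frobenius1 A ord_max) <= M.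
Proof.
have M0 : 0 <= M by exact: le_trans M_ge1.
apply: specnorm_le => // v.
have -> : v = \mxcol_(i < k.+1) (submxcol v i : 'cV[C]_n) by rewrite submxcolK.
rewrite frobenius1_L1_mxcol; apply: vnorm2_mxcol_le => // i.
case: ifP => _; last by rewrite ler_peMl ?vnorm2_ge0.
by rewrite (le_trans (vnorm2_mulmx _ _)) // ler_wpM2r ?vnorm2_ge0.
Qed.

(** Cauchy-Schwarz on the first block row and the shift in the others bound the square by
    [k.+1 M^2 + 1], which is at most [(k.+1 M)^2] because [k.+1 >= 2] and [M >= 1]. *)
Lemma specnorm_frobenius1_L0_le : specnorm (frobenius1 A ord0) <= k.+1%:R * M.
Proof.
have M0 : 0 <= M by exact: le_trans M_ge1.
have KM0 : 0 <= k.+1%:R * M by rewrite mulr_ge0.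
rewrite -specnormN; apply: specnorm_le => // v.
have -> : v = \mxcol_(i < k.+1) (submxcol v i : 'cV[C]_n) by rewrite submxcolK.
set y := fun i : 'I_k.+1 => (submxcol v i : 'cV[C]_n).
rewrite (frobenius1_L0_mxcol A y); apply: vnorm2_le_sqr => //.
rewrite !vnorm2_sqr_mxcol big_ord_recl /= vnorm2N.
set s := \sum_(i < k.+1) vnorm2 (y i) ^+ 2.
have s0 : 0 <= s by apply: sumr_ge0 => i _; exact: sqr_ge0.
have H1 : vnorm2 (\sum_(j < k.+1) A (inord (k - j)) *m y j) ^+ 2 <= k.+1%:R * M ^+ 2 * s.
  apply: (@le_trans _ _ ((\sum_(j < k.+1) M * vnorm2 (y j)) ^+ 2)).
    rewrite ler_pXn2r ?nnegrE ?vnorm2_ge0 //; last first.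
      by apply: sumr_ge0 => i _; rewrite mulr_ge0 ?vnorm2_ge0.
    apply: (le_trans (vnorm2_sum _)); apply: ler_sum => i _.
    by rewrite (le_trans (vnorm2_mulmx _ _)) // ler_wpM2r ?vnorm2_ge0.
  apply: (le_trans (sum_mul_sqr_le _ _)); rewrite sumr_const card_ord.
  by rewrite -[M ^+ 2 *+ _]mulr_natl.
have H2 : \sum_(i < k) vnorm2 (y (inord i)) ^+ 2 <= s.
  rewrite /s big_ord_recr /= ler_wpDr ?sqr_ge0 //.
  apply: ler_sum => i _; rewrite le_eqVlt; apply/orP; left; apply/eqP.
  by congr (vnorm2 (y _) ^+ 2); apply: val_inj; rewrite /= inordK // ltnS ltnW.
apply: (le_trans (lerD H1 H2)); rewrite -[X in _ + X]mul1r -mulrDl ler_wpM2r //.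
have : 1 <= M ^+ 2 by rewrite expr_ge1.
have : 2 <= k.+1%:R :> R by rewrite ler_nat.
rewrite exprMn; set K := k.+1%:R; nra.
Qed.

Lemma specnorm_frobenius1_L1_ge : (0 < n)%N ->
  Num.max 1 (specnorm (A ord_max)) <= specnorm (frobenius1 A ord_max).
Proof.
move=> n0; rewrite ge_max /frobenius1 /pencil /=; set D := mxdiag _.
have D0 : submxblock D ord0 ord0 = A ord_max by rewrite submxblock_diag.
have Dk : submxblock D ord_max ord_max = 1%:M.
  by rewrite submxblock_diag /= ifN // -lt0n.
rewrite -D0 specnorm_submxblock andbT (le_trans (specnorm1_ge1 n0)) //.
by rewrite -Dk specnorm_submxblock.
Qed.

Lemma specnorm_frobenius1_L0_ge : (0 < n)%N ->
  \big[Num.max/1]_(i < k.+1) specnorm (A (widen_ord (leqnSn k.+1) i)) <=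
    specnorm (frobenius1 A ord0).
Proof.
move=> n0; rewrite /frobenius1 /pencil /= specnormN; set D := mxblock _.
apply/bigmax_leP; split => [|i _].
  have i1 : (inord 1 : 'I_k.+1) = 1 :> nat by rewrite inordK.
  have D1 : submxblock D (inord 1) ord0 = 1%:M by rewrite mxblockK i1.
  by rewrite (le_trans (specnorm1_ge1 n0)) // -D1 specnorm_submxblock.
have := specnorm_submxblock D ord0 (rev_ord i).
by rewrite mxblockK /= specnormN rev_ordK.
Qed.

Section Vectors.
Variables (delta : C) (w : 'rV[C]_n) (x : 'cV[C]_n).
Hypothesis wA : w *m mpeval A delta = 0.
Let d := normc delta.
Let g j := vnorm2 (w *m horner_shift A delta j)^T.

Let M_ge0 : 0 <= M. Proof. exact: le_trans M_ge1. Qed.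

Let wA_le i : vnorm2 (w *m A i)^T <= M * vnorm2 w^T.
Proof. by rewrite (le_trans (vnorm2_mulmxl _ _)) // ler_wpM2r ?vnorm2_ge0. Qed.

Lemma horner_shift_norm_small j : d <= 1 -> g j <= j.+1%:R * M * vnorm2 w^T.
Proof.
move=> d1; elim: j => [|j IH]; first by rewrite /g /= mul1r.
rewrite /g /= mulmxDr -scalemxAr linearD linearZ /=.
apply: (le_trans (vnorm2D _ _)); rewrite vnorm2Z -/d -/(g j) -natr1 2!mulrDl mul1r.
apply: lerD => //; apply: le_trans IH; rewrite ler_piMl //; exact: vnorm2_ge0.
Qed.

(** [2 M |w|] is the fixed point of [g |-> g / 2 + M |w|], which dominates the forward recursion;
    hence a bound uniform in [j]. *)
Lemma horner_shift_norm_half j : d <= 1 / 2 -> g j <= 2 * M * vnorm2 w^T.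
Proof.
have Mw : 0 <= M * vnorm2 w^T by rewrite mulr_ge0 ?vnorm2_ge0.
move=> d1; elim: j => [|j IH].
  by rewrite /g /= (le_trans (wA_le _)) // -mulrA ler_peMl // ler1n.
rewrite /g /= mulmxDr -scalemxAr linearD linearZ /=.
apply: (le_trans (vnorm2D _ _)); rewrite vnorm2Z -/d -/(g j).
have := wA_le (inord (k - j)).
have : d * g j <= 1 / 2 * (2 * M * vnorm2 w^T).
  by apply: ler_pM => //; [exact: normc_ge0|exact: vnorm2_ge0].
set a := vnorm2 (w *m A _)^T; lra.
Qed.

(** Each backward step [delta w H_j = w H_(j+1) - w A_(k-j)] adds at most [M |w|]. The factor [d] is
    kept on the left: the decay in [1 / d] is what the case of large [|delta|] exploits. *)
Lemma horner_shift_norm_large m : 1 <= d -> (m <= k.+1)%N ->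
  d * g (k.+1 - m) <= m%:R * M * vnorm2 w^T.
Proof.
move=> d1; elim: m => [|m IH] mk.
  by rewrite subn0 /g horner_shift_mpeval wA trmx0 vnorm20 !(mul0r, mulr0).
set j := (k.+1 - m.+1)%N; have jE : (k.+1 - m)%N = j.+1 by rewrite /j subSS subSn.
have H : d * g j <= g j.+1 + M * vnorm2 w^T.
  have -> : d * g j = vnorm2 ((w *m horner_shift A delta j.+1)^T -
      (w *m A (inord (k - j)))^T).
    by rewrite -vnorm2Z -linearZ -linearB /= mulmxDr addrK scalemxAr.
  rewrite (le_trans (vnorm2D _ _)) // vnorm2N lerD //.
apply: (le_trans H); rewrite -natr1 2!mulrDl mul1r lerD2r.
have := IH (ltnW mk); rewrite jE; apply: le_trans.
by rewrite ler_peMl // vnorm2_ge0.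
Qed.

Lemma vnorm2_frobenius1_left_le c : 0 <= c ->
  (forall j, (0 < j <= k)%N -> g j <= c * vnorm2 w^T) ->
  vnorm2 (frobenius1_left A delta w)^T ^+ 2 <=
    (1 + k%:R * c ^+ 2) * vnorm2 w^T ^+ 2.
Proof.
move=> c0 H; rewrite /frobenius1_left tr_mxrow vnorm2_sqr_mxcol big_ord_recl /=.
rewrite mulrDl mul1r lerD2l -mulrA mulr_natl -[X in _ *+ X](card_ord k) -sumr_const.
apply: ler_sum => i _; rewrite -exprMn.
rewrite ler_pXn2r ?nnegrE ?mulr_ge0 ?vnorm2_ge0 //; apply: (H i.+1).
exact: ltn_ord.
Qed.

Lemma vnorm2_frobenius1_left_ge :
  vnorm2 w^T <= vnorm2 (frobenius1_left A delta w)^T.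
Proof.
rewrite /frobenius1_left tr_mxrow.
by apply: le_trans (vnorm2_submxcol_le _ ord0); rewrite mxcolK.
Qed.

Let T := Num.max 1 d.

Lemma vnorm2_frobenius1_right_le :
  vnorm2 (frobenius1_right delta x : 'cV_(\sum_(i < k.+1) n)) ^+ 2 <=
    k.+1%:R * (T ^+ k * vnorm2 x) ^+ 2.
Proof.
rewrite vnorm2_sqr_mxcol mulr_natl -[X in _ *+ X](card_ord k.+1) -sumr_const.
have T1 : 1 <= T by rewrite le_max lexx.
have T0 : 0 <= T by exact: le_trans T1.
apply: ler_sum => i _; rewrite vnorm2Z normcX.
rewrite ler_pXn2r ?nnegrE ?mulr_ge0 ?exprn_ge0 ?vnorm2_ge0 ?normc_ge0 //.
rewrite ler_wpM2r ?vnorm2_ge0 //; apply: (@le_trans _ _ (T ^+ (k - i))).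
  by rewrite lerXn2r ?nnegrE ?normc_ge0 // le_max lexx orbT.
by rewrite ler_weXn2l // leq_subr.
Qed.

(** A geometric series of ratio [d^2 <= 1/4]; its bound 4/3 is stable under [q |-> 1 + q / 4]. *)
Lemma vnorm2_frobenius1_right_half : d <= 1 / 2 ->
  vnorm2 (frobenius1_right delta x : 'cV_(\sum_(i < k.+1) n)) ^+ 2 <=
    4 / 3 * vnorm2 x ^+ 2.
Proof.
move=> dh; rewrite vnorm2_sqr_mxcol.
under eq_bigr => i _ do rewrite vnorm2Z exprMn normcX.
rewrite -mulr_suml ler_wpM2r ?sqr_ge0 // (reindex_inj rev_ord_inj) /=.
under eq_bigr => i _ do rewrite subSS subKn ?leq_ord // exprAC.
elim: k.+1 => [|m IH]; first by rewrite big_ord0 divr_ge0.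
rewrite big_ord_recl expr0 /=.
under eq_bigr => i _ do rewrite /bump /= add1n (exprS _ i).
rewrite -mulr_sumr -/d; move: IH; rewrite -/d.
set q := \sum_(i < m) _ => IH.
have q0 : 0 <= q by apply: sumr_ge0 => i _; rewrite exprn_ge0 // sqr_ge0.
have d2 : d ^+ 2 <= 1 / 4 by have : 0 <= d by [exact: normc_ge0]; nra.
nra.
Qed.

Lemma vnorm2_frobenius1_right_ge :
  T ^+ k * vnorm2 x <= vnorm2 (frobenius1_right delta x : 'cV_(\sum_(i < k.+1) n)).
Proof.
have H (i : 'I_k.+1) : d ^+ (k - i) * vnorm2 x <=
   vnorm2 (frobenius1_right delta x : 'cV_(\sum_(i < k.+1) n)).
  by apply: le_trans (vnorm2_submxcol_le _ i); rewrite mxcolK vnorm2Z normcX.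
have [d1|d1] := leP 1 d.
  by have := H ord0; rewrite subn0 /T (max_r d1).
by have := H ord_max; rewrite subnn expr0 /T (max_l (ltW d1)) expr1n.
Qed.

End Vectors.
End FrobeniusNorms.

(** * The ratio as a product of norms *)

Section Ratio.
Context {R : realType} {k n : nat}.
Local Notation C := R[i].
Variables (A : matpoly R k.+1 n) (delta : C) (x : 'cV[C]_n)
  (z : 'cV[C]_(\sum_(i < k.+1) n)).
Hypotheses (hreg : regular A) (hsimple : simple_eigenvalue A delta)
  (hdelta : delta != 0) (hx : right_eigvec A delta x)
  (hz : right_eigvec (frobenius1 A) delta z)
  (hw : 0 < mpweight A delta) (hwC : 0 < mpweight (frobenius1 A) delta).

Lemma frobenius1_rightZ (c : C) (u : 'cV[C]_n) :
  frobenius1_right delta (c *: u) =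
  c *: (frobenius1_right delta u : 'cV_(\sum_(i < k.+1) n)).
Proof. by apply/matrixP => i j; rewrite !mxE mulrCA. Qed.

(** The eigenvector [z] is arbitrary, but the kernel of the pencil is a line, so [z] is a multiple
    of the explicit right vector. The scalar cancels between [|z|] and the denominator, and
    [|delta|] and [w P'(delta) x] cancel in the quotient. *)
Lemma condnum_frobenius1_ratio : exists w : 'rV[C]_n,
  [/\ w *m mpeval A delta = 0, 0 < vnorm2 w^T &
  condnum (frobenius1 A) delta z / condnum A delta x =
  mpweight (frobenius1 A) delta * (vnorm2 (frobenius1_left A delta w)^T / vnorm2 w^T) *
  (vnorm2 (frobenius1_right delta x : 'cV_(\sum_(i < k.+1) n)) / vnorm2 x) /
  mpweight A delta].
Proof.
have [w [wA wb ker]] := simple_eigenvalue_left hreg hsimple hx.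
have [x0 Ax] := hx; have [z0 Cz] := hz.
have w0 : 0 < vnorm2 w^T.
  rewrite vnorm2_gt0; apply: contraNneq wb => /(congr1 trmx).
  by rewrite trmxK trmx0 => ->; rewrite !mul0mx mxE.
exists w; split => //.
have [u Au zu] := frobenius1_kernel Cz.
have [c uc] := ker u Au.
have zE : z = c *: frobenius1_right delta x by rewrite zu uc frobenius1_rightZ.
have c0 : c != 0 by apply: contraNneq z0 => c0; rewrite zE c0 scale0r.
have zb : (frobenius1_left A delta w *m mpderiv (frobenius1 A) delta *m z) 0 0 =
    c * (w *m mpderiv A delta *m x) 0 0.
  by rewrite mpderiv_frobenius1 zE -scalemxAr frobenius1_left_right mxE.
have kerC v : mpeval (frobenius1 A) delta *m v = 0 -> exists a, v = a *: z.
  move=> /frobenius1_kernel[y Ay ->]; have [a ->] := ker y Ay.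
  by exists (a / c); rewrite frobenius1_rightZ zE scalerA divfK.
rewrite (condnumE hdelta wA Ax ker wb hw).
rewrite (condnumE hdelta (frobenius1_left_eigvec wA) Cz kerC) //; last first.
  by rewrite zb mulf_neq0.
rewrite zb normcM zE vnorm2Z; field.
by rewrite !gt_eqF // ?vnorm2_gt0 ?normc_gt0.
Qed.

End Ratio.

(** * The resulting inequalities between reals *)

Section RealEstimates.
Context {R : realType}.
Implicit Types d m a M S SC N T t p q c : R.

(** Only the two extreme terms are kept, which is why the denominator of [rho'] involves only the
    first and last coefficients. *)
Lemma weighted_sum_ge k (f : 'I_k.+2 -> R) d m : 0 <= d -> 0 <= m ->
  (forall i, 0 <= f i) -> m <= f ord0 -> m <= f ord_max ->
  m * Num.max 1 d ^+ k.+1 <= \sum_(i < k.+2) d ^+ i * f i.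
Proof.
move=> d0 m0 f0 mf0 mfk.
rewrite big_ord_recl big_ord_recr /= expr0 mul1r.
rewrite (_ : lift ord0 ord_max = ord_max); last exact: val_inj.
set s := \sum_(i < k) _; have s0 : 0 <= s.
  by apply: sumr_ge0 => i _; rewrite mulr_ge0 ?exprn_ge0.
have dk0 : 0 <= d ^+ k.+1 by rewrite exprn_ge0.
have dm : d ^+ k.+1 * m <= d ^+ k.+1 * f ord_max by rewrite ler_wpM2l.
have dm0 : 0 <= d ^+ k.+1 * m by rewrite mulr_ge0.
have [d1|d1] := leP 1 d; last by rewrite expr1n mulr1 /bump add1n; lra.
by rewrite /bump add1n mulrC; lra.
Qed.

Lemma weighted_sum_le k (f : 'I_k.+2 -> R) d a : 0 <= d -> (forall i, 0 <= f i) ->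
  (forall i, f i <= a) ->
  \sum_(i < k.+2) d ^+ i * f i <= (k.+1%:R + 1) * a * Num.max 1 d ^+ k.+1.
Proof.
move=> d0 f0 fa; rewrite natr1 -mulrA mulr_natl -[X in _ *+ X](card_ord k.+2) -sumr_const.
have T1 : 1 <= Num.max 1 d by rewrite le_max lexx.
have T0 : 0 <= Num.max 1 d by exact: le_trans T1.
apply: ler_sum => i _; rewrite mulrC; apply: ler_pM; rewrite ?exprn_ge0 //.
apply: (@le_trans _ _ (Num.max 1 d ^+ i)).
  by rewrite lerXn2r ?nnegrE // le_max lexx orbT.
by rewrite ler_weXn2l // leq_ord.
Qed.

Lemma mul_max_le_weight N l0 l1 d : 0 <= N -> 0 <= d -> N <= l0 -> N <= l1 ->
  N * Num.max 1 d <= l0 + d * l1.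
Proof.
move=> N0 d0 h0 h1; have Nd : d * N <= d * l1 by rewrite ler_wpM2l.
have dN : 0 <= d * N by rewrite mulr_ge0.
by have [d1|d1] := leP 1 d; [rewrite mulrC|]; lra.
Qed.

Lemma weight_ratio_ge k S SC N a d p q : 0 < S -> 0 < a -> 0 <= N -> 0 <= d ->
  S <= (k.+1%:R + 1) * a * Num.max 1 d ^+ k.+1 -> N * Num.max 1 d <= SC ->
  1 <= p -> Num.max 1 d ^+ k <= q -> N / a / (k.+1%:R + 1) <= SC * p * q / S.
Proof.
set T := Num.max 1 d; move=> S0 a0 N0 d0 ST SCN p1 qT.
have T0 : 0 <= T by rewrite le_max ler01.
have K0 : 0 < k.+1%:R + 1 :> R by rewrite natr1 ltr0n.
have NT0 : 0 <= N * T by rewrite mulr_ge0.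
rewrite ler_pdivrMr // mulrAC ler_pdivlMr // mulrAC ler_pdivrMr //.
apply: (@le_trans _ _ (N * ((k.+1%:R + 1) * a * T ^+ k.+1))); first by rewrite ler_wpM2l.
have step : N * T * T ^+ k <= SC * p * q.
  apply: ler_pM; rewrite ?exprn_ge0 //.
  by rewrite -[X in X <= _]mulr1; apply: ler_pM.
rewrite [leLHS](_ : _ = (N * T * T ^+ k) * (k.+1%:R + 1) * a); last by rewrite exprS; ring.
by rewrite ler_wpM2r ?(ltW a0) // ler_wpM2r // ltW.
Qed.

(** The powers of [T] cancel. [c] is what the two eigenvector norms contribute besides [M] and
    [T^k]. *)
Lemma weight_ratio_le k S SC M m T p q c : 0 < S -> 0 < m -> 0 <= M -> 0 <= T ->
  0 <= c -> m * T ^+ k.+1 <= S -> 0 <= SC -> SC <= (k.+1%:R + 1) * M * T ->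
  0 <= p -> 0 <= q -> (p * q) ^+ 2 <= (c * M * T ^+ k) ^+ 2 ->
  SC * p * q / S <= (k.+1%:R + 1) * c * (M ^+ 2 / m).
Proof.
move=> S0 m0 M0 T0 c0 ST SC0 SCT p0 q0 H.
set K := k.+1%:R + 1 in SCT *.
have K0 : 0 <= K by rewrite /K natr1.
have cMT : 0 <= c * M * T ^+ k by rewrite !mulr_ge0 ?exprn_ge0.
have pq : p * q <= c * M * T ^+ k by rewrite -(@ler_pXn2r _ 2) ?nnegrE ?mulr_ge0 ?exprn_ge0.
rewrite ler_pdivrMr //; apply: (@le_trans _ _ (K * M * T * (c * M * T ^+ k))).
  by rewrite -mulrA; apply: ler_pM; rewrite ?mulr_ge0.
apply: (@le_trans _ _ (K * c * (M ^+ 2 / m) * (m * T ^+ k.+1))).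
  rewrite le_eqVlt; apply/orP; left; apply/eqP; rewrite (exprS T); field.
  by rewrite gt_eqF.
by rewrite ler_wpM2l // !mulr_ge0 // invr_ge0 ltW.
Qed.

(** Since [1 <= kp^2 M^2], the bound on [p^2] is at most [kp^3 M^2]; the factor [kp] in the bound on
    [q^2] completes the square. *)
Lemma general_constant_le k (kp := k.+1%:R : R) M t p q : 1 <= M ->
  p ^+ 2 <= 1 + k%:R * (kp * M) ^+ 2 -> q ^+ 2 <= kp * t ^+ 2 ->
  (p * q) ^+ 2 <= (kp ^+ 2 * M * t) ^+ 2.
Proof.
move=> M1 pk qk; have kE : k%:R = kp - 1 by rewrite /kp -natr1 addrK.
have kp1 : 1 <= kp by rewrite /kp ler1n.
rewrite exprMn; apply: (@le_trans _ _ ((kp ^+ 3 * M ^+ 2) * (kp * t ^+ 2))); last first.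
  by rewrite le_eqVlt; apply/orP; left; apply/eqP; ring.
apply: ler_pM; rewrite ?sqr_ge0 //; apply: (le_trans pk); rewrite kE.
have : 1 <= kp ^+ 2 * M ^+ 2 by rewrite -exprMn exprn_ege1 // mulr_ege1.
rewrite exprMn exprS; set y := kp ^+ 2 * M ^+ 2; rewrite -[kp * kp ^+ 2 * _]mulrA -/y; lra.
Qed.

Lemma constant_le k :
  (k.+1%:R + 1) * k.+1%:R ^+ 2 <= 2 * Num.sqrt 2 * k.+1%:R ^+ 3 :> R.
Proof.
have s2 : 1 <= Num.sqrt 2 :> R by rewrite -{1}sqrtr1 ler_wsqrtr // ler1n.
have k1 : 1 <= k.+1%:R :> R by rewrite ler1n.
rewrite [k.+1%:R ^+ 3]exprS mulrA ler_wpM2r ?sqr_ge0 //; nra.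
Qed.

(** The threshold [k^3 <= d^2] is what makes [k (k M / d)^2 <= M^2], so [p^2 <= 2 M^2]. The rest is
    [2 kp <= kp^2 <= (16/9) kp^2]. *)
Lemma large_constant_le k (kp := k.+1%:R : R) M t p q d : (0 < k)%N -> 1 <= M ->
  0 < d -> k%:R ^+ 3 <= d ^+ 2 -> p ^+ 2 <= 1 + k%:R * (k%:R * M / d) ^+ 2 ->
  q ^+ 2 <= kp * t ^+ 2 -> (p * q) ^+ 2 <= (4 / 3 * kp * M * t) ^+ 2.
Proof.
move=> k0 M1 d0 kd pk qk; have kp2 : 2 <= kp by rewrite /kp ler_nat.
have M2 : 1 <= M ^+ 2 by rewrite exprn_ege1.
have pk2 : p ^+ 2 <= 2 * M ^+ 2.
  apply: (le_trans pk).
  have -> : k%:R * (k%:R * M / d) ^+ 2 = (k%:R ^+ 3 / d ^+ 2) * M ^+ 2.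
    by field; rewrite gt_eqF.
  have : k%:R ^+ 3 / d ^+ 2 <= 1 by rewrite ler_pdivrMr ?exprn_gt0 // mul1r.
  set y := _ / _ => y1; have : y * M ^+ 2 <= 1 * M ^+ 2 by rewrite ler_wpM2r // sqr_ge0.
  lra.
rewrite exprMn; apply: (@le_trans _ _ (2 * M ^+ 2 * (kp * t ^+ 2))).
  by apply: ler_pM; rewrite ?sqr_ge0.
rewrite [leLHS](_ : _ = 2 * kp * (M ^+ 2 * t ^+ 2)); last by ring.
rewrite [leRHS](_ : _ = 16 / 9 * kp ^+ 2 * (M ^+ 2 * t ^+ 2)); last by field.
have kk : 2 * kp <= kp ^+ 2 by rewrite expr2 ler_wpM2r // (le_trans _ kp2).
by apply: ler_wpM2r; [exact: mulr_ge0 (sqr_ge0 _) (sqr_ge0 _)|lra].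
Qed.

(** With [p^2 <= (4 kp - 3) M^2] the claim reduces to [(4/9) (2 kp - 3)^2 >= 0]. *)
Lemma small_constant_le k (kp := k.+1%:R : R) M p q : 1 <= M ->
  p ^+ 2 <= 1 + k%:R * (2 * M) ^+ 2 -> q ^+ 2 <= 4 / 3 ->
  (p * q) ^+ 2 <= (4 / 3 * kp * M) ^+ 2.
Proof.
move=> M1 pk qk; have kE : k%:R = kp - 1 by rewrite /kp -natr1 addrK.
have M2 : 1 <= M ^+ 2 by rewrite exprn_ege1.
rewrite exprMn; apply: (@le_trans _ _ ((4 * kp - 3) * M ^+ 2 * (4 / 3))).
  by apply: ler_pM; rewrite ?sqr_ge0 //; apply: (le_trans pk); rewrite kE; lra.
rewrite [leRHS]exprMn mulrAC ler_wpM2r ?sqr_ge0 // -subr_ge0.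
rewrite [X in 0 <= X](_ : _ = 4 / 9 * (2 * kp - 3) ^+ 2); last by field.
by rewrite mulr_ge0 ?sqr_ge0 ?divr_ge0.
Qed.

End RealEstimates.

(** * The bounds on the ratio of condition numbers *)

Theorem theorem6p7 (R : realType) (k n : nat) (hk : (2 <= k)%N)
    (A : matpoly R k n) (hdeg : A ord_max != 0) (hreg : regular A)
    (hA0 : A ord0 != 0)
    (delta : R[i]) (hsimple : simple_eigenvalue A delta) (hdelta : delta != 0)
    (x : 'cV[R[i]]_n) (hx : right_eigvec A delta x)
    (z : 'cV[R[i]]_(\sum_(i < k) n))
    (hz : right_eigvec (frobenius1 A) delta z) :
  let ratio := condnum (frobenius1 A) delta z / condnum A delta x in
  [/\ nu A / (k%:R + 1) <= ratio,
      ratio <= 2 * Num.sqrt 2 * k%:R ^+ 3 * rho' A &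
      (Num.sqrt ((k%:R - 1) ^+ 3) <= normc delta \/ normc delta <= 1 / 2) ->
      ratio <= 4 / 3 * k%:R * (1 + k%:R) * rho' A].
Proof.
(* From here on [k] is the degree minus one. *)
case: k hk A hdeg hreg hA0 hsimple x hx z hz => // k; rewrite ltnS => hk.
move=> A hdeg hreg hA0 hsimple x hx z hz ratio.
have n_gt0 : (0 < n)%N.
  case: n A hdeg {hreg hA0 hsimple x hx z hz ratio} => // A.
  by rewrite [A _]flatmx0 eqxx.
set d := normc delta.
have d0 : 0 < d by rewrite normc_gt0.
have d0' : 0 <= d by exact: ltW.
have [m [mE mK m00 m0]] : exists m,
  [/\ m = Num.min (specnorm (A ord_max)) (specnorm (A ord0)),
    m <= specnorm (A ord_max), m <= specnorm (A ord0) & 0 < m].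
  exists (Num.min (specnorm (A ord_max)) (specnorm (A ord0))).
  have := specnorm_gt0 hdeg; have := specnorm_gt0 hA0.
  move: (specnorm (A ord_max)) (specnorm (A ord0)) => u v u0 v0.
  by rewrite !ge_min !lexx orbT lt_min u0 v0.
(* [M] is the square root of the numerator of [rho'], which avoids exchanging a maximum with
   squaring. *)
have [M [M1 AM rhoE]] : exists M, [/\ 1 <= M, forall i, specnorm (A i) <= M &
    rho' A = M ^+ 2 / m].
  set M2 := \big[Num.max/1]_(i < k.+2) (specnorm (A i) ^+ 2).
  have M21 : 1 <= M2 by exact: bigmax_ge_id.
  have ME : Num.sqrt M2 ^+ 2 = M2 by rewrite sqr_sqrtr // (le_trans ler01).
  exists (Num.sqrt M2); split; last by rewrite ME mE.
    by rewrite -{1}sqrtr1; apply: ler_wsqrtr.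
  move=> i; rewrite -(@ler_pXn2r _ 2) ?nnegrE ?specnorm_ge0 ?sqrtr_ge0 // ME.
  exact: (le_bigmax 1 (fun i => specnorm (A i) ^+ 2)).
have M0 : 0 <= M by exact: le_trans M1.
set T := Num.max 1 d.
have T1 : 1 <= T by rewrite le_max lexx.
have T0 : 0 <= T by exact: le_trans T1.
have dT : d <= T by rewrite le_max lexx orbT.
have [S SE] : exists S, S = mpweight A delta by eexists.
have ST : m * T ^+ k.+1 <= S.
  rewrite SE; exact: (weighted_sum_ge (f := fun i => specnorm (A i)) d0' (ltW m0)
    (fun i => specnorm_ge0 (A i)) m00 mK).
have S0 : 0 < S by apply: lt_le_trans ST; rewrite mulr_gt0 // exprn_gt0 // (lt_le_trans ltr01).
have [SC SCE] : exists SC, SC = mpweight (frobenius1 A) delta by eexists.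
have kp2 : 2 <= k.+1%:R :> R by rewrite ler_nat.
have SCle : SC <= (k.+1%:R + 1) * M * T.
  have H0 := specnorm_frobenius1_L0_le hk M1 AM.
  have H1 := specnorm_frobenius1_L1_le M1 AM.
  rewrite SCE mpweight_deg1 [leRHS](_ : _ = k.+1%:R * M * T + T * M); last by ring.
  apply: lerD; first by apply: (le_trans H0); rewrite ler_peMr // mulr_ge0.
  by apply: ler_pM; [exact: d0'|exact: specnorm_ge0| |].
have [N [NE N1 SCge]] : exists N, [/\ N = Num.min (Num.max 1 (specnorm (A ord_max)))
    (\big[Num.max/1]_(i < k.+1) specnorm (A (widen_ord (leqnSn k.+1) i))),
    1 <= N & N * T <= SC].
  have := specnorm_frobenius1_L1_ge A hk n_gt0.
  have := specnorm_frobenius1_L0_ge A hk n_gt0.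
  set N1 := Num.max 1 _; set N0 := \big[Num.max/1]_(i < k.+1) _.
  have N11 : 1 <= N1 by rewrite /N1 le_max lexx.
  have N01 : 1 <= N0 by exact: bigmax_ge_id.
  rewrite SCE mpweight_deg1 -/d; clearbody N0 N1.
  move: (specnorm (frobenius1 A ord0)) (specnorm (frobenius1 A ord_max)).
  move=> l0 l1 h0 h1; exists (Num.min N1 N0).
  have m1 : 1 <= Num.min N1 N0 by rewrite le_min N11.
  have [n1 n2] : Num.min N1 N0 <= N1 /\ Num.min N1 N0 <= N0.
    by rewrite !ge_min !lexx orbT.
  split => //; apply: mul_max_le_weight; rewrite ?(le_trans ler01 m1) //.
    exact: le_trans n2 h0.
  exact: le_trans n1 h1.
have SC0 : 0 < SC.
  by apply: lt_le_trans SCge; rewrite mulr_gt0 ?(lt_le_trans ltr01).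
have [w [wA w0]] : exists w : 'rV[R[i]]_n, [/\ w *m mpeval A delta = 0,
    0 < vnorm2 w^T & ratio = SC * (vnorm2 (frobenius1_left A delta w)^T / vnorm2 w^T) *
     (vnorm2 (frobenius1_right delta x : 'cV_(\sum_(i < k.+1) n)) / vnorm2 x) / S].
  by move: S0 SC0; rewrite SE SCE; exact: condnum_frobenius1_ratio.
have x0 : 0 < vnorm2 x by rewrite vnorm2_gt0; case: hx.
have p1 := vnorm2_frobenius1_left_ge A delta w.
have pc := vnorm2_frobenius1_left_le (A := A) (delta := delta) (w := w).
have q1 := vnorm2_frobenius1_right_ge (k := k) delta x.
have q2 := vnorm2_frobenius1_right_le (k := k) delta x.
have qh := vnorm2_frobenius1_right_half (k := k) (delta := delta) x.
have gs := horner_shift_norm_small AM (delta := delta) w.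
have gh := horner_shift_norm_half M1 AM (delta := delta) w.
have gl := horner_shift_norm_large AM wA.
move: p1 pc q1 q2 qh gs gh gl; rewrite -/d -/T.
set nW := vnorm2 (frobenius1_left A delta w)^T.
set nZ := vnorm2 (frobenius1_right delta x).
set nw := vnorm2 w^T in w0 *; set nx := vnorm2 x in x0 *.
move=> p1 pc q1 q2 qh gs gh gl.
set p := nW / nw; set q := nZ / nx => ratioE.
have nWE : nW = p * nw by rewrite /p divfK // gt_eqF.
have nZE : nZ = q * nx by rewrite /q divfK // gt_eqF.
clearbody p q.
move: p1 pc q1 q2 qh; rewrite nWE nZE => p1 pc q1 q2 qh.
have p_ge1 : 1 <= p by rewrite -(ler_pM2r w0) mul1r.
have q_geT : T ^+ k <= q by rewrite -(ler_pM2r x0).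
have p_le c : 0 <= c -> (forall j, (0 < j <= k)%N ->
    vnorm2 (w *m horner_shift A delta j)^T <= c * nw) ->
    p ^+ 2 <= 1 + k%:R * c ^+ 2.
  by move=> c0 H; rewrite -(ler_pM2r (exprn_gt0 2 w0)) -exprMn; exact: pc.
have q_le : q ^+ 2 <= k.+1%:R * (T ^+ k) ^+ 2.
  by rewrite -(ler_pM2r (exprn_gt0 2 x0)) -(exprMn 2 q) -[leRHS]mulrA -exprMn.
have q_half : d <= 1 / 2 -> q ^+ 2 <= 4 / 3.
  by move=> dh; rewrite -(ler_pM2r (exprn_gt0 2 x0)) -exprMn; exact: qh.
have w0' : 0 <= nw by exact: ltW.
clear p1 q1 q2 qh pc nWE nZE; clearbody nw; clear nW nZ.
have p0 : 0 <= p by exact: le_trans p_ge1.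
have q0 : 0 <= q by apply: le_trans q_geT; rewrite exprn_ge0.
have upper c : 0 <= c -> (p * q) ^+ 2 <= (c * M * T ^+ k) ^+ 2 ->
    ratio <= (k.+1%:R + 1) * c * rho' A.
  by move=> c0 H; rewrite ratioE rhoE; apply: weight_ratio_le H => //; exact: ltW.
have rho0 : 0 <= rho' A by rewrite rhoE mulr_ge0 ?sqr_ge0 // invr_ge0 ltW.
split.
- have [a [aE aA]] : exists a, a = \big[Num.max/0]_(i < k.+2) specnorm (A i) /\
      forall i, specnorm (A i) <= a.
    eexists; split; first by [].
    by move=> i; exact: (le_bigmax 0 (fun i => specnorm (A i))).
  have a0 : 0 < a by apply: (lt_le_trans m0); apply: le_trans m00 (aA _).
  rewrite ratioE /nu -aE -NE.
  apply: (weight_ratio_ge S0 a0 (le_trans ler01 N1) d0' _ SCge p_ge1 q_geT).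
  rewrite SE; exact: (weighted_sum_le (f := fun i => specnorm (A i)) d0'
    (fun i => specnorm_ge0 (A i)) aA).
- apply: (@le_trans _ _ ((k.+1%:R + 1) * k.+1%:R ^+ 2 * rho' A)).
    apply: upper; first exact: sqr_ge0.
    apply: general_constant_le => //; apply: p_le => [|j /andP[j0 jk]].
      by rewrite mulr_ge0.
    (* The forward recursion collects [j.+1] terms of size [M |w|], the backward one [k.+1 - j];
       both counts are at most [k.+1]. *)
    have [d1|d1] := leP d 1.
      apply: (le_trans (gs j d1)); rewrite ler_wpM2r // ler_wpM2r //.
      by rewrite ler_nat ltnS.
    have := gl (k.+1 - j)%N (ltW d1) (leq_subr _ _).
    rewrite subKn; last exact: leqW.
    move=> H; apply: (@le_trans _ _ (d * vnorm2 (w *m horner_shift A delta j)^T)).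
      by rewrite ler_peMl ?vnorm2_ge0 // ltW.
    apply: (le_trans H); rewrite ler_wpM2r // ler_wpM2r //.
    by rewrite ler_nat leq_subr.
  rewrite ler_wpM2r //.
  exact: constant_le.
move=> hd.
rewrite (_ : 4 / 3 * k.+1%:R * (1 + k.+1%:R) = (k.+1%:R + 1) * (4 / 3 * k.+1%:R));
  last by ring.
apply: upper; first by rewrite !mulr_ge0 // invr_ge0.
case: hd => [dk|dh]; last first.
  have dT1 : T = 1.
    by rewrite /T max_l // (le_trans dh) // ler_pdivrMr // mul1r ler1n.
  rewrite dT1 expr1n mulr1; apply: small_constant_le; rewrite ?q_half //.
  by apply: p_le => [|j _]; [rewrite mulr_ge0|exact: gh].
have k3d : k%:R ^+ 3 <= d ^+ 2.
  move: dk; rewrite -/d -natr1 addrK => dk.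
  by rewrite -[leLHS]sqr_sqrtr ?exprn_ge0 // ler_pXn2r ?nnegrE ?sqrtr_ge0.
have d1 : 1 <= d.
  rewrite -(@ler_pXn2r _ 2) ?nnegrE // expr1n.
  by apply: le_trans k3d; rewrite exprn_ege1 // ler1n.
apply: large_constant_le k3d _ q_le => //.
(* Block 0 of the left vector being [w] itself, only [j > 0] matters, so the backward recursion
   takes at most [k] steps. This gives [k M / d], and with it the cube of the degree minus one in
   the threshold. *)
apply: p_le => [|j /andP[j0 jk]]; first by rewrite !mulr_ge0 // invr_ge0.
have := gl (k.+1 - j)%N d1 (leq_subr _ _).
rewrite subKn; last exact: leqW.
move=> H; rewrite mulrAC ler_pdivlMr // mulrC; apply: (le_trans H).
rewrite ler_wpM2r // ler_wpM2r // ler_nat leq_subLR.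
by rewrite -[k.+1]add1n leq_add2r.
Qed.
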